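(* Let $N$ be an $n$-dimensional Riemannian manifold, $\varrho:\mathbb R\to\mathbb R$ a positive function and $\bar M^{n+1}=\mathbb R\times_\varrho N$ the warped product. Let $F:N\to\mathbb R$ be a transnormal function, with $\nabla F$ nowhere zero. Then the graph $\{(F(x),x): x\in N\}\subset\bar M$ has a canonical principal direction relative to the vector field $\partial_t$.
   Context: All objects are smooth. The warped product $\mathbb R\times_\varrho N$ is $\mathbb R\times N$ with the metric $dt^2+\varrho(t)^2 g_N$, where $g_N$ is the metric of $N$; $\partial_t$ is the lift of the standard unit vector field on $\mathbb R$. A differentiable function $F:N\to\mathbb R$ is transnormal if $|\nabla F|=b\circ F$ for some non-negative function $b$ (gradient and norm with respect to $g_N$). An orientable hypersurface $M$ with unit normal $\xi$ has a canonical principal direction relative to a vector field $X$, where $X^T=X-\langle X,\xi\rangle\xi$ is nowhere zero on $M$, if $X^T$ is at each point an eigenvector of the shape operator of $M$. For the graph of $F$ and $X=\partial_t$, the condition that $X^T$ be nowhere zero is equivalent to $\nabla F$ being nowhere zero. *)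

(* Defs.v *)
From HB Require Import structures.
From mathcomp Require Import all_boot all_order all_algebra.
From mathcomp Require Import all_classical all_reals all_analysis.

Set Implicit Arguments.
Unset Strict Implicit.
Unset Printing Implicit Defensive.

Import Order.TTheory GRing.Theory Num.Theory.
Import numFieldNormedType.Exports.

Local Open Scope classical_set_scope.
Local Open Scope ring_scope.

(* Manifolds are given by an atlas; every tensorial object is given by its
   components in each chart, subject to the usual transformation laws.  The
   components attached to a chart [c] and a point [p] are meaningful only when
   [dom c p] holds; coordinates are row vectors. *)

(* [U] is meant to be open. *)
Fixpoint Ck (R : realType) (V W : normedModType R) (k : nat) (U : set V)
    (f : V -> W) : Prop :=
  match k with
  | 0 => forall x, U x -> {for x, continuous f}
  | k'.+1 => (forall x, U x -> differentiable f x) /\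
             (forall v : V, Ck k' U (fun x => 'D_v f x))
  end.

Definition smooth_on (R : realType) (V W : normedModType R) (U : set V)
    (f : V -> W) : Prop := forall k, Ck k U f.

(* [coord c] and [param c] are total functions; they are mutually inverse
   between [dom c] and the open set [coord c @` dom c]. *)
Record riemannian_data (R : realType) (n : nat) := RiemannianData {
  carrier :> topologicalType;
  chart : Type;
  dom : chart -> set carrier;
  coord : chart -> carrier -> 'rV[R]_n;
  param : chart -> 'rV[R]_n -> carrier;
  gram : chart -> carrier -> 'M[R]_n }.

Section Geometry.
Context (R : realType) (n : nat) (M : riemannian_data R n).
Implicit Types (c d : chart M) (p q : M) (v w : 'rV[R]_n) (U : set M).

Definition inner c p v w : R := (v *m gram c p *m w^T) 0 0.

Definition gnorm c p v : R := Num.sqrt (inner c p v v).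

(* Components in [d] of the tangent vector at [p] with components [v] in [c]. *)
Definition transport c d p v : 'rV[R]_n :=
  'd (coord d \o param c) (coord c p) v.

Record is_riemannian_manifold : Prop := IsRiemannianManifold {
  rm_hausdorff : hausdorff_space M;
  rm_second_countable : @second_countable M;
  rm_cover : forall p, exists c, dom c p;
  rm_open_dom : forall c, open (dom c);
  rm_open_coord : forall c, open (coord c @` dom c);
  rm_coordK : forall c p, dom c p -> param c (coord c p) = p;
  rm_coord_continuous : forall c p, dom c p -> {for p, continuous (coord c)};
  rm_param_continuous : forall c p, dom c p ->
    {for coord c p, continuous (param c)};
  rm_transition : forall c d,
    smooth_on (coord c @` (dom c `&` dom d)) (coord d \o param c);
  rm_gram_smooth : forall c, smooth_on (coord c @` dom c) (gram c \o param c);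
  rm_gram_sym : forall c p, dom c p -> (gram c p)^T = gram c p;
  rm_gram_pos : forall c p v, dom c p -> v != 0 -> 0 < inner c p v v;
  rm_gram_transport : forall c d p v w, dom c p -> dom d p ->
    inner d p (transport c d p v) (transport c d p w) = inner c p v w }.

Definition smooth_fun U (f : M -> R) : Prop :=
  forall c, smooth_on (coord c @` (U `&` dom c)) (f \o param c).

Definition pderiv c (i : 'I_n) (f : M -> R) p : R :=
  'D_(delta_mx 0 i) (f \o param c) (coord c p).

Definition differential c (f : M -> R) p : 'rV[R]_n := \row_i pderiv c i f p.

Definition vector_field := M -> chart M -> 'rV[R]_n.

Definition smooth_vector_field U (X : vector_field) : Prop :=
  (forall p c d, U p -> dom c p -> dom d p ->
     X p d = transport c d p (X p c)) /\
  (forall c, smooth_on (coord c @` (U `&` dom c))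
     (fun y => X (param c y) c)).

Definition gradient (f : M -> R) : vector_field :=
  fun p c => differential c f p *m invmx (gram c p).

(* [b] need not be smooth, and only its values on the range of [f] matter. *)
Definition transnormal (f : M -> R) : Prop :=
  exists b : R -> R, (forall s, 0 <= b s) /\
    forall p c, dom c p -> gnorm c p (gradient f p c) = b (f p).

(* Christoffel symbol Gamma^k_ij of the Levi-Civita connection. *)
Definition christoffel c p (k i j : 'I_n) : R :=
  2^-1 * \sum_(l < n) invmx (gram c p) k l *
    (pderiv c i (fun q => gram c q j l) p
     + pderiv c j (fun q => gram c q i l) p
     - pderiv c l (fun q => gram c q i j) p).

(* Components in [c] of the covariant derivative of [X] at [p] along [v]. *)
Definition covariant_derivative c p v (X : vector_field) : 'rV[R]_n :=
  'D_v (fun y => X (param c y) c) (coord c p)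
  + \row_k \sum_(i < n) \sum_(j < n)
      christoffel c p k i j * v 0 i * X p c 0 j.

(* Embedded hypersurface, as a subset that is locally a regular level set. *)
Definition hypersurface (S : set M) : Prop :=
  forall p, S p -> exists (U : set M) (h : M -> R),
    [/\ open U, U p, smooth_fun U h,
        (forall q c, U q -> dom c q -> differential c h q != 0) &
        S `&` U = [set q | U q /\ h q = 0]].

(* [v] is the velocity at time 0 of a smooth curve in [S] through [p]. *)
Definition tangent (S : set M) c p v : Prop :=
  exists (g : R -> M) (e : R),
    [/\ 0 < e, g 0 = p,
        (forall s, `|s| < e -> S (g s) /\ dom c (g s)),
        smooth_on [set s : R | `|s| < e] (coord c \o g) &
        'D_1 (coord c \o g) 0 = v].

Definition local_extension (S : set M) (xi : vector_field) p U
    (Xi : vector_field) : Prop :=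
  [/\ open U, U p, smooth_vector_field U Xi &
      forall q c, S q -> U q -> dom c q -> Xi q c = xi q c].

(* [xi] is a field along [S]: its values outside [S] are irrelevant. *)
Definition unit_normal (S : set M) (xi : vector_field) : Prop :=
  (forall p, S p -> exists U Xi, local_extension S xi p U Xi) /\
  (forall p c, S p -> dom c p ->
     gnorm c p (xi p c) = 1 /\
     forall v, tangent S c p v -> inner c p v (xi p c) = 0).

(* The shape operator A v = - nabla_v xi of [S] with respect to [xi] sends [v]
   to [w].  For [v] tangent to [S], nabla_v Xi does not depend on the extension
   Xi of [xi], and such extensions exist when [xi] is a unit normal. *)
Definition shape_operator (S : set M) (xi : vector_field) c p v w : Prop :=
  forall U Xi, local_extension S xi p U Xi ->
    - covariant_derivative c p v Xi = w.

Definition tangential_part (xi X : vector_field) : vector_field :=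
  fun p c => X p c - inner c p (X p c) (xi p c) *: xi p c.

(* The existence of a unit normal is the orientability of [S]. *)
Definition canonical_principal_direction (S : set M) (X : vector_field) : Prop :=
  [/\ hypersurface S,
      exists xi, unit_normal S xi &
      forall xi, unit_normal S xi -> forall p, S p ->
        (forall c, dom c p -> tangential_part xi X p c != 0) /\
        exists lambda : R, forall c, dom c p ->
          shape_operator S xi c p (tangential_part xi X p c)
            (lambda *: tangential_part xi X p c)].

End Geometry.

Section WarpedProduct.
Context (R : realType) (n : nat) (rho : R -> R) (N : riemannian_data R n).

Definition warped_product : riemannian_data R (1 + n) :=
  @RiemannianData R (1 + n) (R * N)%type (chart N)
    (fun c => [set q | dom c q.2])
    (fun c q => row_mx q.1%:M (coord c q.2))
    (fun c y => (y 0 0, param c (rsubmx y)))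
    (fun c q => block_mx 1%:M 0 0 (rho q.1 ^+ 2 *: gram c q.2)).

(* Every chart of the product is (id, coord c), so the components of the lift of
   d/dt are the same in all of them. *)
Definition partial_t : vector_field warped_product :=
  fun _ _ => row_mx 1%:M 0.

Definition graph_of (F : N -> R) : set warped_product :=
  range (fun x : N => (F x, x)).

End WarpedProduct.

Arguments partial_t {R n} rho N _ _.
Arguments graph_of {R n} rho {N} F _.

(* Main.v *)
Require Import Defs.
From HB Require Import structures.
From mathcomp Require Import all_boot all_order all_algebra.
From mathcomp Require Import ring lra.
From mathcomp Require Import all_classical all_reals all_analysis.
Import Defs.
Import Order.TTheory GRing.Theory Num.Theory.
Import numFieldNormedType.Exports.
Local Open Scope classical_set_scope.
Local Open Scope ring_scope.
Set Implicit Arguments.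
Unset Strict Implicit.
Unset Printing Implicit Defensive.

(** Write [f] for the gradient of [F] on [N], [u] for its squared norm and [x]
    for a point of [N].  Transnormality says that [u = B (F x)] with
    [B = b ^+ 2]; what makes the gradient direction special is the consequence
    [du = B'(F x) dF].

    The graph is the zero set of [t - F x], so its unit normals at the point
    over [x] are the two vectors [xi = (a, - a / rho^2 f)] with
    [a^2 = rho^2 / (rho^2 + u)], and the tangential part of [d/dt] is
    [T = (u, f) / (rho^2 + u)] ([unit_normalE], [tangential_partE]).

    To see that [nabla_T xi] is a multiple of [T] it suffices to pair it with
    [xi] and with the tangent vectors [Y = (dF w, w)].  Two relations hold all
    along the graph: [xi] has norm 1 and is orthogonal to every [Y].
    Differentiating them along [T] expresses the pairings of the coordinate
    derivative of [xi] through derivatives of the metric and the Hessian of [F]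
    ([local_extension_derive]); this works for any unit normal and any
    extension, and never requires knowing which of the two normals is given.
    The Christoffel terms are a combination of three derivatives of the metric
    ([inner_christoffel]).  In the sum the derivatives of the metric of [N]
    along [f] cancel, and what is left is the derivative of [u] along [w]
    ([derive_sqr_gradient], where the symmetry of second derivatives enters),
    together with multiples of [dF w] that come from the derivative of [rho].
    As [du] is [B'(F x) dF], everything is a multiple of [dF w], which is the
    pairing of [T] with [Y].  Hence [nabla_T xi] is a multiple of [T]
    ([covariant_derivative_tangential]); the factor involves the chart only
    through [a], which is the same in all charts.

    Since [b] is an arbitrary function, the derivative of [B] has to be
    obtained first: along a coordinate line in the direction [f], [F] is a local
    diffeomorphism [phi] of the real line and [u] is [B \o phi]
    ([derivable_B]).  The existence of a unit normal, which the conclusion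
    includes, needs the smoothness of [f] and of the normalizing factor, hence a
    calculus of C^k functions closed under products, inverses, square roots and
    inverse matrices. *)

(** * Calculus of C^k functions *)

Section Differentiation.
Context {R : realType}.
Implicit Types V W : normedModType R.

(** The differential [ 'd f x ] is chosen from the values of [f] everywhere, so
    locality has to go through its characterization by the expansion at [x]. *)
Lemma near_eq_differentiable V W (f g : V -> W) (x : V) :
  {near x, f =1 g} -> differentiable f x -> differentiable g x.
Proof.
move=> fg df; have [dfc Ef] := (diff_locallyP x f).1 df.
have fgx : f x = g x by exact: (nbhs_singleton fg).
have Eg : g \o shift x = cst (g x) + 'd f x +o_ 0 id.
  apply/eqaddoP => e e0.
  move/eqaddoP: Ef => /(_ e e0) Ef.
  have sfg : \forall h \near 0, f (h + x) = g (h + x).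
    move: fg; rewrite (near_shift 0 x) => {}fg.
    by near=> h; rewrite -[x]subr0; near: h; exact: fg.
  near=> h; have gfh : (g \o shift x) h = (f \o shift x) h.
    by apply/esym; near: h; exact: sfg.
  rewrite /= in gfh *; rewrite !fctE gfh -fgx; near: h; exact: Ef.
apply/diff_locallyP.
have dgE : 'd g x = 'd f x :> (V -> W) by exact: diff_unique.
by rewrite dgE.
Unshelve. all: by end_near. Qed.

Lemma derive_comp V1 V W (f : V1 -> V) (g : V -> W) x v :
  differentiable f x -> differentiable g (f x) ->
  'D_v (g \o f) x = 'D_('D_v f x) g (f x).
Proof.
move=> df dg.
rewrite deriveE; last exact: differentiable_comp.
by rewrite diff_comp//= -!deriveE.
Qed.

Lemma deriveZv V W (g : V -> W) (k : R) (v y : V) :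
  differentiable g y -> 'D_(k *: v) g y = k *: 'D_v g y.
Proof. by move=> dg; rewrite !deriveE// linearZ. Qed.

Lemma derive_scalar (f : R -> R) (a t : R) : differentiable f t ->
  'D_a f t = a * 'D_1 f t.
Proof.
by move=> df; rewrite -[a in LHS]mulr1 [LHS]deriveZv.
Qed.

(** On an open set the derivatives up to order [k] see only the values there;
    this is how a derivative computed at the points of [U] is substituted for
    the globally defined [ 'D_v f ] in every induction below. *)
Lemma Ck_eq V W k (U : set V) (f g : V -> W) :
  open U -> {in U, f =1 g} -> Ck k U f -> Ck k U g.
Proof.
move=> Uo; have nearfg (f' g' : V -> W) x : {in U, f' =1 g'} -> U x ->
    {near x, f' =1 g'}.
  move=> fg Ux; near=> y; apply: fg; rewrite inE; near: y.
  exact: open_nbhs_nbhs.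
elim: k f g => [|k IH] f g fg /=.
  move=> cf x Ux; suff: g @ x --> g x by [].
  rewrite -fg ?inE//.
  apply: cvg_trans (cf _ Ux); apply: near_eq_cvg.
  exact: (nearfg f g).
move=> [df Ddf]; split=> [x Ux|v].
  by apply: near_eq_differentiable (df _ Ux); exact: nearfg.
apply: IH (Ddf v) => x; rewrite inE => Ux.
by apply: near_eq_derive; exact: nearfg.
Unshelve. all: by end_near. Qed.

Lemma Ck_sub V W k (A B : set V) (f : V -> W) :
  B `<=` A -> Ck k A f -> Ck k B f.
Proof.
move=> BA; elim: k f => [|k IH] f /=; first by move=> cf x /BA; exact: cf.
by move=> [df Ddf]; split=> [x /BA|v]; [exact: df|exact: IH].
Qed.

Lemma CkW V W k (U : set V) (f : V -> W) : Ck k.+1 U f -> Ck k U f.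
Proof.
elim: k f => [|k IH] f; first by case=> df _ x /df/differentiable_continuous.
by case=> df Ddf; split=> // v; apply: IH.
Qed.

Lemma Ck_cst V W k (U : set V) (a : W) : Ck k U (cst a).
Proof.
elim: k a => [|k IH] a /=; first by move=> x _; exact: cvg_cst.
split=> [x _|v]; first exact: differentiable_cst.
by under eq_fun do rewrite derive_cst; exact: IH.
Qed.

(** This covers the coordinates of a product and the lines in a chart.  Since
    [ 'D_v A ] is constant, the directional derivatives of [f \o A] are again
    directional derivatives of [f], in a fixed direction, composed with [A]. *)
Lemma Ck_comp_affine V1 V W k (U : set V) (A : V1 -> V) (L : V1 -> V)
    (f : V -> W) : open U ->
  (forall x, differentiable A x) -> (forall v x, 'D_v A x = L v) ->
  Ck k U f -> Ck k (A @^-1` U) (f \o A).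
Proof.
move=> Uo dA DA; elim: k f => [|k IH] f /=.
  move=> cf x Ux; apply: continuous_comp; last exact: cf.
  exact: differentiable_continuous.
move=> [df Ddf]; split=> [x Ux|v].
  by apply: differentiable_comp; [exact: dA|exact: df].
apply: Ck_eq (IH _ (Ddf (L v))).
  apply: open_comp => // x _; exact: differentiable_continuous.
move=> x; rewrite inE => Ux /=.
by rewrite derive_comp//; [rewrite DA|exact: df].
Qed.

Lemma Ck_affine V W k (U : set V) (A : V -> W) (L : V -> W) :
  (forall x, differentiable A x) -> (forall v x, 'D_v A x = L v) -> Ck k U A.
Proof.
move=> dA DA; case: k => [|k] /=.
  by move=> x _; exact: differentiable_continuous.
by split=> // v; under eq_fun do rewrite DA; exact: Ck_cst.
Qed.

Lemma CkD V W k (U : set V) (f g : V -> W) :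
  open U -> Ck k U f -> Ck k U g -> Ck k U (f + g).
Proof.
move=> Uo; elim: k f g => [|k IH] f g /=.
  by move=> cf cg x Ux; apply: cvgD; [exact: cf|exact: cg].
move=> [df Ddf] [dg Ddg]; split=> [x Ux|v].
  by apply: differentiableD; [exact: df|exact: dg].
apply: Ck_eq (IH _ _ (Ddf v) (Ddg v)) => // x; rewrite inE => Ux.
by rewrite deriveD//; apply: diff_derivable; [exact: df|exact: dg].
Qed.

Lemma CkM V k (U : set V) (f g : V -> R) :
  open U -> Ck k U f -> Ck k U g -> Ck k U (f * g).
Proof.
move=> Uo; elim: k f g => [|k IH] f g.
  by move=> cf cg x Ux; apply: cvgM; [exact: cf|exact: cg].
move=> Cf Cg; have [[df Ddf] [dg Ddg]] := (Cf, Cg); split=> [x Ux|v].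
  by apply: differentiableM; [exact: df|exact: dg].
apply: Ck_eq (CkD Uo (IH _ _ (CkW Cf) (Ddg v)) (IH _ _ (CkW Cg) (Ddf v))) => //.
move=> x; rewrite inE => Ux.
by rewrite deriveM//; apply: diff_derivable; [exact: df|exact: dg].
Qed.

Lemma Ck_sum V W k (U : set V) (I : Type) (s : seq I) (P : pred I)
    (f : I -> V -> W) : open U -> (forall i, Ck k U (f i)) ->
  Ck k U (fun x => \sum_(i <- s | P i) f i x).
Proof.
move=> Uo Cf; elim: s => [|i s IH].
  by apply: (Ck_eq Uo _ (Ck_cst k U 0)) => x _; rewrite big_nil.
have [Pi|Pi] := boolP (P i); last first.
  by apply: Ck_eq IH => // x _; rewrite big_cons (negbTE Pi).
by apply: (Ck_eq Uo _ (CkD Uo (Cf i) IH)) => x _; rewrite big_cons Pi.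
Qed.

Lemma Ck_prod V k (U : set V) (I : Type) (s : seq I) (P : pred I)
    (f : I -> V -> R) : open U -> (forall i, Ck k U (f i)) ->
  Ck k U (fun x => \prod_(i <- s | P i) f i x).
Proof.
move=> Uo Cf; elim: s => [|i s IH].
  by apply: (Ck_eq Uo _ (@Ck_cst V R k U 1)) => x _; rewrite big_nil.
have [Pi|Pi] := boolP (P i); last first.
  by apply: Ck_eq IH => // x _; rewrite big_cons (negbTE Pi).
by apply: (Ck_eq Uo _ (CkM Uo (Cf i) IH)) => x _; rewrite big_cons Pi.
Qed.

(** The inverse reappears in its own derivative, so the induction on the order
    runs on the inverse itself; likewise for the square root below. *)
Lemma CkV V k (U : set V) (f : V -> R) :
  open U -> (forall x, U x -> f x != 0) -> Ck k U f ->
  Ck k U (fun x => (f x)^-1).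
Proof.
move=> Uo f0; elim: k f f0 => [|k IH] f f0.
  by move=> cf x Ux; apply: cvgV; [exact: f0|exact: cf].
move=> Cf; have [df Ddf] := Cf; split=> [x Ux|v].
  by apply: differentiableV; [exact: df|exact: f0].
have CVf := IH _ f0 (CkW Cf).
have CN1 := @Ck_cst V R k U (-1).
apply: Ck_eq (CkM Uo (CkM Uo CN1 (CkM Uo CVf CVf)) (Ddf v)) => // x.
rewrite inE => Ux.
rewrite deriveV//; [|exact: f0|by apply: diff_derivable; exact: df].
by rewrite !fctE mulN1r -invfM -expr2.
Qed.

Lemma Ck_sqrt V k (U : set V) (f : V -> R) :
  open U -> (forall x, U x -> 0 < f x) -> Ck k U f ->
  Ck k U (fun x => Num.sqrt (f x)).
Proof.
move=> Uo f0; elim: k f f0 => [|k IH] f f0.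
  move=> cf x Ux; apply: continuous_comp (cf x Ux) _.
  exact: sqrt_continuous.
move=> Cf; have [df Ddf] := Cf.
have dsqrt x : U x -> differentiable Num.sqrt (f x).
  by move=> Ux; apply/derivable1_diffP; have [] := is_derive1_sqrt (f0 x Ux).
split=> [x Ux|v]; first by apply: differentiable_comp (df _ Ux) (dsqrt _ Ux).
have Csqrt := IH _ f0 (CkW Cf).
have CV : Ck k U (fun x => (2 * Num.sqrt (f x))^-1).
  apply: CkV => // [x Ux|]; first by rewrite mulf_neq0// gt_eqF ?sqrtr_gt0 ?f0.
  exact: CkM (Ck_cst _ _ _) Csqrt.
apply: Ck_eq (CkM Uo CV (Ddf v)) => // x; rewrite inE => Ux.
rewrite (derive_comp _ (df _ Ux) (dsqrt _ Ux)).
rewrite deriveE; last exact: dsqrt.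
rewrite diff1E; last exact: dsqrt.
by rewrite derive1E derive_sqrt ?f0// !fctE mulrC.
Qed.

Lemma differentiable_mxP V m n (f : V -> 'M[R]_(m, n)) x :
  differentiable f x <-> forall i j, differentiable (fun y => f y i j) x.
Proof.
split=> [df i j|df].
  exact: (differentiable_comp df (differentiable_coord (f x) i j)).
have -> : f = \sum_(i < m) \sum_(j < n) (fun y => f y i j *: delta_mx i j).
  apply/funext => y; rewrite {1}[f y]matrix_sum_delta fct_sumE.
  by apply: eq_bigr => i _; rewrite fct_sumE.
apply: differentiable_sum => i; apply: differentiable_sum => j.
exact: differentiableZl.
Qed.

Lemma CkZl V W k (U : set V) (g : V -> R) (a : W) :
  open U -> Ck k U g -> Ck k U (fun x => g x *: a).
Proof.
move=> Uo; elim: k g => [|k IH] g.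
  by move=> cg x Ux; apply: continuousZr_tmp; exact: cg.
move=> [dg Ddg]; split=> [x Ux|v]; first by apply: differentiableZl; exact: dg.
apply: Ck_eq (IH _ (Ddg v)) => // x; rewrite inE => Ux.
rewrite !deriveE ?diffZl//; do ?[exact: dg].
by apply: differentiableZl; exact: dg.
Qed.

Lemma Ck_mxP V m n k (U : set V) (f : V -> 'M[R]_(m, n)) : open U ->
  Ck k U f <-> forall i j, Ck k U (fun x => f x i j).
Proof.
move=> Uo; split=> [Cf i j|Cf].
  elim: k f Cf => [|k IH] f.
    move=> cf x Ux.
    exact: (@continuous_comp _ _ _ f (fun M : 'M[R]_(m, n) => M i j) x
      (cf x Ux) (@coord_continuous _ _ _ i j (f x))).
  move=> [df Ddf]; split=> [x Ux|v].
    by have /differentiable_mxP := df _ Ux.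
  apply: Ck_eq (IH _ (Ddf v)) => // x; rewrite inE => Ux.
  by rewrite derive_mx ?mxE//; apply: diff_derivable; exact: df.
have -> : f = (fun x => \sum_(i < m) \sum_(j < n) (f x i j *: delta_mx i j)).
  by apply/funext => y; rewrite {1}[f y]matrix_sum_delta.
apply: Ck_sum => // i; apply: Ck_sum => // j.
exact: CkZl.
Qed.

Lemma Ck_det V n k (U : set V) (A : V -> 'M[R]_n) :
  open U -> Ck k U A -> Ck k U (fun x => \det (A x)).
Proof.
move=> Uo /(Ck_mxP _ _ Uo) CA; apply: Ck_sum => // s.
apply: CkM => //; first exact: Ck_cst.
by apply: Ck_prod => // i; exact: CA.
Qed.

(** By Cramer's rule the entries are quotients of determinants. *)
Lemma Ck_invmx V n k (U : set V) (A : V -> 'M[R]_n) :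
  open U -> (forall x, U x -> A x \in unitmx) -> Ck k U A ->
  Ck k U (fun x => invmx (A x)).
Proof.
move=> Uo uA CA; have CA' := (Ck_mxP _ _ Uo).1 CA.
apply/(Ck_mxP _ _ Uo) => i j.
apply: (@Ck_eq _ _ _ _ (fun x => (\det (A x))^-1 * cofactor (A x) j i)) => //.
  by move=> x; rewrite inE => Ux; rewrite /invmx uA// !mxE.
apply: CkM => //; first apply: CkV => // [x Ux|].
- by rewrite -unitfE -unitmxE uA.
- exact: Ck_det.
apply: CkM => //; first exact: Ck_cst.
apply: Ck_det => //; apply/(Ck_mxP _ _ Uo) => i' j'.
apply: Ck_eq (CA' (lift j i') (lift i j')) => // x _.
by rewrite !mxE.
Qed.

Lemma Ck_scale V m n k (U : set V) (f : V -> R) (g : V -> 'M[R]_(m, n)) :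
  open U -> Ck k U f -> Ck k U g -> Ck k U (fun y => f y *: g y).
Proof.
move=> Uo Cf /(Ck_mxP _ _ Uo) Cg; apply/(Ck_mxP _ _ Uo) => i j.
by apply: (Ck_eq Uo _ (CkM Uo Cf (Cg i j))) => y _; rewrite [RHS]mxE.
Qed.

End Differentiation.

(** * Symmetry of second derivatives *)

Section Lines.
Context {R : realType}.
Implicit Types V W : normedModType R.

Lemma is_diff_line V (v y : V) (t : R) :
  is_diff t (fun s : R => s *: v + y) (fun s => s *: v).
Proof. by apply: is_diff_eq; rewrite addr0. Qed.

Lemma derive_line V (v y : V) (s t : R) :
  'D_s (fun u : R => u *: v + y) t = s *: v.
Proof.
have [d E] := is_diff_line v y t.
by rewrite deriveE// E.
Qed.

Lemma is_derive_along V W (f : V -> W) (v y : V) (t : R) :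
  differentiable f (t *: v + y) ->
  is_derive t 1 (fun s => f (s *: v + y)) ('D_v f (t *: v + y)).
Proof.
move=> df; have [d _] := is_diff_line v y t; apply: DeriveDef.
  by apply/derivable1_diffP; exact: (differentiable_comp d df).
by have := @derive_comp R R V W _ f t 1 d df; rewrite derive_line scale1r.
Qed.

Lemma near_parallelogram V (P : set V) (x v w : V) : (\near x, P x) ->
  exists2 s : R, 0 < s &
    forall a b, `|a| <= s -> `|b| <= s -> P (a *: v + (b *: w + x)).
Proof.
move=> /nbhs_ballP[e /= e0 eP].
have N0 : 0 < `|v| + `|w| + 1 by rewrite ltr_wpDl// addr_ge0.
exists (e / (`|v| + `|w| + 1)) => [|a b ha hb]; first by rewrite divr_gt0.
apply: eP; rewrite -ball_normE /ball_/= addrA distrC addrK.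
apply: le_lt_trans (ler_normD _ _) _; rewrite !normrZ.
apply: (@le_lt_trans _ _ (e / (`|v| + `|w| + 1) * (`|v| + `|w|))).
  by rewrite mulrDr lerD// ler_wpM2r.
by rewrite -mulrA gtr_pMr// mulrC ltr_pdivrMr// mul1r ltrDl.
Qed.

Lemma MVT_line V (f : V -> R) (v y : V) (s : R) : 0 < s ->
  (forall t, 0 <= t <= s -> differentiable f (t *: v + y)) ->
  exists2 t, 0 <= t <= s & f (s *: v + y) - f y = s * 'D_v f (t *: v + y).
Proof.
move=> s0 df; have df' (t : R) : t \in `[0, s]%R ->
    is_derive t 1 (fun t => f (t *: v + y)) ('D_v f (t *: v + y)).
  by rewrite in_itv => /df/is_derive_along.
have df'' (t : R) : t \in `]0, s[%R ->
    is_derive t 1 (fun t => f (t *: v + y)) ('D_v f (t *: v + y)).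
  by rewrite in_itv => /andP[t0 ts]; apply: df'; rewrite in_itv/= !ltW.
have cf : {within `[0, s], continuous (fun t : R => f (t *: v + y))}.
  by apply: derivable_within_continuous => t /df'[].
have [t] := MVT_segment (ltW s0) df'' cf.
by rewrite in_itv scale0r add0r subr0 => ts ->; exists t; rewrite // mulrC.
Qed.

(** Two applications of the mean value theorem, first in the direction [v] to
    the increment of [f] along [s *: w], then in the direction [w]. *)
Lemma second_difference V (U : set V) (f : V -> R) (x v w : V) (s : R) :
  Ck 2 U f -> 0 < s ->
  (forall a b, 0 <= a <= s -> 0 <= b <= s -> U (a *: v + (b *: w + x))) ->
  exists a b, [/\ 0 <= a <= s, 0 <= b <= s &
    f (s *: v + (s *: w + x)) - f (s *: w + x) - (f (s *: v + x) - f x) =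
    s * (s * 'D_w (fun y => 'D_v f y) (a *: v + (b *: w + x)))].
Proof.
move=> [df Ddf] s0 Us; have s00 : (0 : R) <= 0 <= s by rewrite lexx ltW.
have ss : 0 <= s <= s by rewrite ltW/=.
pose g := f \o +%R (s *: w) - f.
have dg y : U y -> U (s *: w + y) -> differentiable g y /\
    'D_v g y = 'D_v f (s *: w + y) - 'D_v f y.
  move=> Uy Usy; have [dsh dshE] : is_diff y ( +%R (s *: w)) id.
    by apply: is_diff_eq; rewrite add0r.
  have Dsh : 'D_v ( +%R (s *: w)) y = v.
    by rewrite deriveE// dshE.
  have dfs : differentiable (f \o +%R (s *: w)) y.
    by apply: differentiable_comp => //; exact: df.
  split; first by apply: differentiableB => //; exact: df.
  rewrite deriveB ?(derive_comp _ dsh) ?Dsh//; first exact: df.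
    exact: diff_derivable.
  by apply: diff_derivable; exact: df.
have Uxa a : 0 <= a <= s -> U (a *: v + x).
  by move=> /Us/(_ s00); rewrite scale0r add0r.
have Uwxa a : 0 <= a <= s -> U (s *: w + (a *: v + x)).
  by move=> /Us/(_ ss); rewrite addrCA.
have [//||a ha] := @MVT_line V g v x s.
  by move=> t ht; have [] := dg _ (Uxa _ ht) (Uwxa _ ht).
have [_ ->] := dg _ (Uxa _ ha) (Uwxa _ ha).
have [//||b hb ->] := @MVT_line V (fun y => 'D_v f y) w (a *: v + x) s.
  move=> t ht; have [+ _] := Ddf v; apply.
  by rewrite addrCA; exact: Us.
rewrite [b *: w + _]addrCA => E; exists a, b; split=> //; rewrite -E.
rewrite /g /= !fctE /= [s *: v + (s *: w + x)]addrCA !opprD !opprK -!addrA.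
by congr (_ + _); rewrite addrCA.
Qed.

(** The second difference over a small parallelogram is symmetric in [v] and
    [w], and by [second_difference] it is, up to the factor [s ^+ 2], a mixed
    second derivative at a nearby point, in either order; both are continuous
    at [x]. *)
Lemma derive_comm V (U : set V) (f : V -> R) (x v w : V) :
  open U -> U x -> Ck 2 U f ->
  'D_v (fun y => 'D_w f y) x = 'D_w (fun y => 'D_v f y) x.
Proof.
move=> Uo Ux Cf; apply/eqP; rewrite -subr_eq0 -normr_le0 leNgt.
suff H (e : R) : 0 < e ->
    `|'D_v (fun y => 'D_w f y) x - 'D_w (fun y => 'D_v f y) x| < e.
  by apply/negP => /H; rewrite ltxx.
move=> e0.
pose P y := [/\ U y,
  `|'D_v (fun z => 'D_w f z) x - 'D_v (fun z => 'D_w f z) y| < e / 2 &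
  `|'D_w (fun z => 'D_v f z) x - 'D_w (fun z => 'D_v f z) y| < e / 2].
have /near_parallelogram nearP : \near x, P x.
  have cDD (a b : V) :
      {for x, continuous (fun y => 'D_a (fun z => 'D_b f z) y)}.
    by have [_ /(_ b)[_ /(_ a) cf]] := Cf; exact: cf.
  have e2 : 0 < e / 2 by rewrite divr_gt0.
  have nearU : \near x, U x by exact: open_nbhs_nbhs.
  have /cvgrPdist_lt/(_ _ e2) nv := cDD v w.
  have /cvgrPdist_lt/(_ _ e2) nw := cDD w v.
  apply: filterS3 nearU nv nw => y h1 h2 h3.
  by split; [exact: h1|exact: h2|exact: h3].
have nearS (a b : V) : exists2 s : R, 0 < s & forall t u,
    0 <= t <= s -> 0 <= u <= s -> P (t *: a + (u *: b + x)).
  have [s s0 sP] := nearP a b; exists s => // t u /andP[t0 ts] /andP[u0 us].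
  by apply: sP; rewrite ger0_norm.
have [s s0 sP] := nearS v w.
have [a [b [ha hb]]] := second_difference Cf s0
  (fun t u ht hu => let: And3 Uy _ _ := sP t u ht hu in Uy).
have sP' t u : 0 <= t <= s -> 0 <= u <= s -> P (t *: w + (u *: v + x)).
  by move=> ht hu; rewrite addrCA; exact: sP.
have [a' [b' [ha' hb']]] := second_difference Cf s0
  (fun t u ht hu => let: And3 Uy _ _ := sP' t u ht hu in Uy).
have -> : f (s *: w + (s *: v + x)) - f (s *: v + x) - (f (s *: w + x) - f x) =
    f (s *: v + (s *: w + x)) - f (s *: w + x) - (f (s *: v + x) - f x).
  rewrite [s *: w + (s *: v + x)]addrCA !opprD !opprK -!addrA.
  by congr (_ + _); rewrite addrCA.
move=> -> /(mulfI (lt0r_neq0 s0))/(mulfI (lt0r_neq0 s0)) DE.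
have tri (A B c : R) : `|A - c| < e / 2 -> `|B - c| < e / 2 -> `|A - B| < e.
  clear -e0 => h1 h2; rewrite (splitr e) (le_lt_trans (ler_distD c _ _))//.
  by rewrite ltrD// distrC.
have [_ _ hw] := sP _ _ ha hb; have [_ hv _] := sP' _ _ ha' hb'.
by rewrite DE in hv; exact: tri hv hw.
Qed.

End Lines.

(** * Differentiability through a local diffeomorphism *)

Section Levels.
Context {R : realType}.

(** Near 0 the function [phi] is injective, because its derivative does not
    vanish, and [B] is [B \o phi] composed with its local inverse, which is
    differentiable by the inverse function theorem in one variable. *)
Lemma derivable_along_diffeo (B phi : R -> R) :
  (\forall t \near (0 : R), differentiable phi t) ->
  {for 0, continuous ('D_1 phi)} ->
  'D_1 phi 0 != 0 -> derivable (B \o phi) 0 1 -> derivable B (phi 0) 1.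
Proof.
move=> dphi cphi' phi'0 dBphi.
have nphi' : \forall t \near (0 : R), 'D_1 phi t != 0.
  exact: cvgr_neq0 cphi' phi'0.
have nd : \forall t \near (0 : R), differentiable phi t by exact: dphi.
have [r /= r0 rP] : exists2 r : R, 0 < r & forall t, `|t| < r ->
    differentiable phi t /\ 'D_1 phi t != 0.
  have nb : nbhs (0 : R) [set t | differentiable phi t /\ 'D_1 phi t != 0].
    exact: filterI nd nphi'.
  move/nbhs_ballP: nb => [r /= r0 rP].
  by exists r => // t tr; apply: rP; rewrite -ball_normE /ball_/= sub0r normrN.
have injlt (a b : R) : `|a| < r -> `|b| < r -> a < b -> phi a != phi b.
  move=> ar br ab; have in_r t : a <= t <= b -> `|t| < r.
    move=> /andP[hat tb]; rewrite ltr_norml.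
    move: ar br; rewrite !ltr_norml => /andP[+ _] /andP[_ +].
    by move=> /lt_le_trans/(_ hat) -> /(le_lt_trans tb).
  have dphi' (t : R) : t \in `[a, b] -> is_derive t 1 phi ('D_1 phi t).
    rewrite in_itv => /in_r/rP[+ _].
    by move=> /derivable1_diffP/derivableP.
  have dphi'' (t : R) : t \in `]a, b[ -> is_derive t 1 phi ('D_1 phi t).
    rewrite in_itv => /andP[h1 h2]; apply: dphi'.
    by rewrite in_itv/= !ltW.
  have cphi : {within `[a, b], continuous phi}.
    by apply: derivable_within_continuous => t /dphi'[].
  have [t] := MVT_segment (ltW ab) dphi'' cphi.
  rewrite in_itv => /in_r/rP[_ t0] /eqP; rewrite -subr_eq0.
  apply: contraTneq => ->; rewrite subrr sub0r oppr_eq0 mulf_neq0//.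
  by rewrite subr_eq0 gt_eqF.
pose g y := xget 0 [set t | `|t| < r /\ phi t = y].
have gK t : `|t| < r -> g (phi t) = t.
  move=> tr; pose Q := [set t' : R | `|t'| < r /\ phi t' = phi t].
  have [] := xgetPex 0 (ex_intro Q t (conj tr erefl)).
  rewrite -/(g (phi t)) => gr gE.
  have [h|h|//] := ltgtP (g (phi t)) t.
    by have := injlt _ _ gr tr h; rewrite gE eqxx.
  by have := injlt _ _ tr gr h; rewrite gE eqxx.
have ngK : {near (0 : R), cancel phi g}.
  have nr : \forall t \near (0 : R), `|t| < r by exact: nbhs0_lt.
  by near=> t; apply: gK; near: t.
have ncphi : {near (0 : R), continuous phi}.
  apply: filterS nd => t; exact: differentiable_continuous.
have d0 : is_derive (0 : R) (1 : R) phi ('D_1 phi 0).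
  by apply/derivableP/derivable1_diffP; have [] := rP 0; rewrite ?normr0.
have dg := is_derive_inverse ngK ncphi d0 phi'0.
have nphiK : {near phi 0, cancel g phi} by exact: near_continuous_can_sym.
apply: (@near_eq_derivable _ _ _ ((B \o phi) \o g)).
  by near=> y; rewrite /=; congr B; near: y.
apply/derivable1_diffP/differentiable_comp; first by apply/derivable1_diffP.
by rewrite gK ?normr0//; apply/derivable1_diffP.
Unshelve. all: by end_near. Qed.
End Levels.

(** * Bilinear forms depending on a point *)

Section Form.
Context {R : realType} {n : nat}.
Implicit Types (A B : 'M[R]_n) (v w : 'rV[R]_n).

Definition mxform A v w : R := (v *m A *m w^T) 0 0.

Lemma mxformDl A v1 v2 w : mxform A (v1 + v2) w = mxform A v1 w + mxform A v2 w.
Proof. by rewrite /mxform !mulmxDl mxE. Qed.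

Lemma mxformZl A k v w : mxform A (k *: v) w = k * mxform A v w.
Proof. by rewrite /mxform -!scalemxAl mxE. Qed.

Lemma mxformZr A k v w : mxform A v (k *: w) = k * mxform A v w.
Proof. by rewrite /mxform linearZ/= -scalemxAr mxE. Qed.

Lemma mxformZm A k v w : mxform (k *: A) v w = k * mxform A v w.
Proof. by rewrite /mxform -scalemxAr -scalemxAl mxE. Qed.

Lemma mxform0l A w : mxform A 0 w = 0.
Proof. by rewrite /mxform !mul0mx mxE. Qed.

Lemma mxform0r A v : mxform A v 0 = 0.
Proof. by rewrite /mxform trmx0 mulmx0 mxE. Qed.

Lemma mxform_sym A v w : A^T = A -> mxform A v w = mxform A w v.
Proof.
move=> AT; rewrite /mxform (_ : v *m A *m w^T = (w *m A *m v^T)^T) ?mxE//.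
by rewrite !trmx_mul trmxK AT mulmxA.
Qed.

Lemma mxformE A v w : mxform A v w = \sum_j \sum_l A j l * v 0 j * w 0 l.
Proof.
rewrite /mxform mxE exchange_big; apply: eq_bigr => l _.
rewrite !mxE mulr_suml; apply: eq_bigr => j _.
by rewrite [v 0 j * _]mulrC.
Qed.

End Form.

Section MatrixDerivatives.
Context {R : realType} {V : normedModType R}.

Lemma derive_mxE m n (A : V -> 'M[R]_(m, n)) x v i j :
  differentiable A x -> ('D_v A x) i j = 'D_v (fun y => A y i j) x.
Proof. by move=> dA; rewrite derive_mx ?mxE//; exact: diff_derivable. Qed.

Lemma differentiable_mulmx m n p (A : V -> 'M[R]_(m, n))
    (B : V -> 'M[R]_(n, p)) x :
  differentiable A x -> differentiable B x ->
  differentiable (fun y => A y *m B y) x.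
Proof.
move=> /differentiable_mxP dA /differentiable_mxP dB.
apply/differentiable_mxP => i k.
have -> : (fun y => (A y *m B y) i k) =
    \sum_(j < n) ((fun y => A y i j) * (fun y => B y j k)).
  by apply/funext => y; rewrite mxE fct_sumE.
by apply: differentiable_sum => j; exact: differentiableM.
Qed.

Lemma derive_mulmx m n p (A : V -> 'M[R]_(m, n)) (B : V -> 'M[R]_(n, p)) x v :
  differentiable A x -> differentiable B x ->
  'D_v (fun y => A y *m B y) x = 'D_v A x *m B x + A x *m 'D_v B x.
Proof.
move=> dA dB; apply/matrixP => i k; rewrite derive_mxE; last first.
  exact: differentiable_mulmx.
have -> : (fun y => (A y *m B y) i k) =
    \sum_(j < n) ((fun y => A y i j) * (fun y => B y j k)).
  by apply/funext => y; rewrite mxE fct_sumE.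
have /differentiable_mxP dA' := dA; have /differentiable_mxP dB' := dB.
rewrite derive_sum => [|j]; last first.
  by apply: derivableM; apply: diff_derivable.
rewrite !mxE -big_split/=; apply: eq_bigr => j _.
rewrite deriveM; [|exact: diff_derivable|exact: diff_derivable].
by rewrite !derive_mxE// addrC; congr (_ + _); exact: mulrC.
Qed.

Lemma differentiable_trmx m n (A : V -> 'M[R]_(m, n)) x :
  differentiable A x -> differentiable (fun y => (A y)^T) x.
Proof.
move=> /differentiable_mxP dA; apply/differentiable_mxP => i j.
by under eq_fun do rewrite mxE.
Qed.

Lemma derive_trmx m n (A : V -> 'M[R]_(m, n)) x v :
  differentiable A x -> 'D_v (fun y => (A y)^T) x = ('D_v A x)^T.
Proof.
move=> dA; apply/matrixP => i j; rewrite derive_mxE; last first.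
  exact: differentiable_trmx.
by rewrite mxE derive_mxE//; under eq_fun do rewrite mxE.
Qed.

Lemma differentiable_mxform n (A : V -> 'M[R]_n) (a b : V -> 'rV[R]_n) x :
  differentiable A x -> differentiable a x -> differentiable b x ->
  differentiable (fun y => mxform (A y) (a y) (b y)) x.
Proof.
move=> dA da db.
have /differentiable_mxP := differentiable_mulmx (differentiable_mulmx da dA)
  (differentiable_trmx db).
exact.
Qed.

Lemma derive_mxform n (A : V -> 'M[R]_n) (a b : V -> 'rV[R]_n) x v :
  differentiable A x -> differentiable a x -> differentiable b x ->
  'D_v (fun y => mxform (A y) (a y) (b y)) x =
  mxform ('D_v A x) (a x) (b x) + mxform (A x) ('D_v a x) (b x)
  + mxform (A x) (a x) ('D_v b x).
Proof.
move=> dA da db; have daA := differentiable_mulmx da dA.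
have dbT := differentiable_trmx db.
rewrite /mxform -derive_mxE; last exact: differentiable_mulmx.
rewrite derive_mulmx// derive_mulmx// derive_trmx// mulmxDl.
by rewrite [LHS]mxE [X in X + _ = _]mxE [X in X + _ = _]addrC.
Qed.

Lemma derive_delta n (g : 'rV[R]_n -> V) x w : differentiable g x ->
  'D_w g x = \sum_i w 0 i *: 'D_(delta_mx 0 i) g x.
Proof.
move=> dg; rewrite deriveE// {1}[w]row_sum_delta linear_sum.
by apply: eq_bigr => i _; rewrite linearZ/= deriveE.
Qed.

End MatrixDerivatives.

Section CkMx.
Context {R : realType} {V : normedModType R} (k : nat) (U : set V).
Hypothesis Uo : open U.

Lemma Ck_mulmx m n p (A : V -> 'M[R]_(m, n)) (B : V -> 'M[R]_(n, p)) :
  Ck k U A -> Ck k U B -> Ck k U (fun y => A y *m B y).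
Proof.
move=> /(Ck_mxP _ _ Uo) CA /(Ck_mxP _ _ Uo) CB; apply/(Ck_mxP _ _ Uo) => i j.
apply: (@Ck_eq _ _ _ _ _ (fun y => \sum_l A y i l * B y l j)) => //.
  by move=> y _; rewrite mxE.
by apply: Ck_sum => // l; apply: CkM.
Qed.

Lemma Ck_mxform n (A : V -> 'M[R]_n) (a b : V -> 'rV[R]_n) :
  Ck k U A -> Ck k U a -> Ck k U b ->
  Ck k U (fun y => mxform (A y) (a y) (b y)).
Proof.
move=> CA Ca Cb; have CbT : Ck k U (fun y => (b y)^T).
  apply/(Ck_mxP _ _ Uo) => i j; have /(Ck_mxP _ _ Uo)/(_ j i) := Cb.
  by apply: Ck_eq => // y _; rewrite mxE.
have /(Ck_mxP _ _ Uo) := Ck_mulmx (Ck_mulmx Ca CA) CbT.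
exact.
Qed.

End CkMx.

(** * Christoffel symbols without indices *)

Section Koszul.
Context {R : realType} {n : nat} (M : riemannian_data R n).
Variables (c : chart M) (p : M).
Hypothesis sym_gram : (gram c p)^T = gram c p.
Hypothesis pos_gram : forall v, v != 0 -> 0 < inner c p v v.

Let Dgram v := 'D_v (gram c \o param c) (coord c p).

Lemma gram_unitmx : gram c p \in unitmx.
Proof.
rewrite -row_free_unit -kermx_eq0; apply/rowV0P => v /sub_kermxP vG.
apply/eqP/contraT => /pos_gram.
by rewrite /inner vG mul0mx mxE ltxx.
Qed.

(** The Christoffel symbols are the inverse metric applied to half a combination
    of first derivatives of the metric; pairing with [w] cancels the inverse and
    leaves the Koszul formula for fields with constant components. *)
Lemma inner_christoffel (v x w : 'rV[R]_n) :
  differentiable (gram c \o param c) (coord c p) ->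
  inner c p (\row_k \sum_(i < n) \sum_(j < n)
      christoffel c p k i j * v 0 i * x 0 j) w =
  2^-1 * (mxform (Dgram v) x w + mxform (Dgram x) v w - mxform (Dgram w) v x).
Proof.
move=> dG.
pose T i j l := pderiv c i (fun q => gram c q j l) p
     + pderiv c j (fun q => gram c q i l) p
     - pderiv c l (fun q => gram c q i j) p.
pose tau : 'rV[R]_n := \row_l \sum_i \sum_j T i j l * v 0 i * x 0 j.
have pE i j l : pderiv c i (fun q => gram c q j l) p = Dgram (delta_mx 0 i) j l.
  by rewrite /Dgram derive_mxE.
have DE u j l : Dgram u j l = \sum_i u 0 i * Dgram (delta_mx 0 i) j l.
  rewrite /Dgram derive_delta// summxE; apply: eq_bigr => i _.
  by rewrite mxE.
have invT : (invmx (gram c p))^T = invmx (gram c p).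
  by rewrite trmx_inv sym_gram.
have invC k l : invmx (gram c p) k l = invmx (gram c p) l k.
  by rewrite -[in LHS]invT mxE.
have -> : \row_k \sum_(i < n) \sum_(j < n) christoffel c p k i j * v 0 i * x 0 j
    = 2^-1 *: (tau *m invmx (gram c p)).
  apply/rowP => k; rewrite !mxE mulr_sumr.
  rewrite [RHS](_ : _ = \sum_l \sum_i \sum_j
     2^-1 * (invmx (gram c p) k l * T i j l) * v 0 i * x 0 j); last first.
    apply: eq_bigr => l _; rewrite mxE mulr_suml mulr_sumr.
    apply: eq_bigr => i _; rewrite mulr_suml mulr_sumr; apply: eq_bigr => j _.
    by rewrite invC; ring.
  rewrite [RHS]exchange_big; apply: eq_bigr => i _.
  rewrite [RHS]exchange_big; apply: eq_bigr => j _.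
  rewrite /christoffel -!mulrA mulr_suml mulr_sumr.
  by apply: eq_bigr => l _; rewrite /T; ring.
rewrite [LHS]mxformZl; congr (_ * _).
transitivity ((tau *m w^T) 0 0); first by rewrite /mxform mulmxKV ?gram_unitmx.
rewrite !mxformE mxE.
rewrite [LHS](_ : _ = \sum_i \sum_j \sum_l
   (Dgram (delta_mx 0 i) j l + Dgram (delta_mx 0 j) i l
    - Dgram (delta_mx 0 l) i j) * v 0 i * x 0 j * w 0 l); last first.
  under eq_bigr do rewrite mxE mulr_suml.
  rewrite exchange_big; apply: eq_bigr => i _.
  under eq_bigr do rewrite mulr_suml.
  rewrite exchange_big; apply: eq_bigr => j _; apply: eq_bigr => l _.
  by rewrite /T !pE [w^T l 0]mxE.
pose S i j l := Dgram (delta_mx 0 i) j l.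
have -> : \sum_j \sum_l Dgram v j l * x 0 j * w 0 l =
    \sum_i \sum_j \sum_l S i j l * v 0 i * x 0 j * w 0 l.
  rewrite [RHS]exchange_big; apply: eq_bigr => j _.
  rewrite [RHS]exchange_big; apply: eq_bigr => l _.
  by rewrite DE !mulr_suml; apply: eq_bigr => i _; rewrite /S; ring.
have -> : \sum_j \sum_l Dgram x j l * v 0 j * w 0 l =
    \sum_i \sum_j \sum_l S j i l * v 0 i * x 0 j * w 0 l.
  apply: eq_bigr => i _; rewrite [RHS]exchange_big; apply: eq_bigr => l _.
  by rewrite DE !mulr_suml; apply: eq_bigr => j _; rewrite /S; ring.
have -> : \sum_i \sum_j Dgram w i j * v 0 i * x 0 j =
    \sum_i \sum_j \sum_l S l i j * v 0 i * x 0 j * w 0 l.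
  apply: eq_bigr => i _; apply: eq_bigr => j _.
  by rewrite DE !mulr_suml; apply: eq_bigr => l _; rewrite /S; ring.
rewrite -big_split -sumrB /=; apply: eq_bigr => i _.
rewrite -big_split -sumrB /=; apply: eq_bigr => j _.
rewrite -big_split -sumrB /=; apply: eq_bigr => l _.
by rewrite /S; ring.
Qed.
End Koszul.

(** * Gradients and changes of charts *)

Section Charts.
Context {R : realType} {n : nat} (M : riemannian_data R n).
Hypothesis hM : is_riemannian_manifold M.
Implicit Types (c d : chart M) (p q : M) (v w : 'rV[R]_n) (f : M -> R).

Lemma near_chart c p (P : set M) : dom c p -> open P -> P p ->
  \forall y \near coord c p,
    [/\ dom c (param c y), coord c (param c y) = y & P (param c y)].
Proof.
move=> cp Po Pp.
have nE : \forall y \near coord c p, (coord c @` dom c) y.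
  by apply: open_nbhs_nbhs; split; [exact: rm_open_coord|exists p].
have nP : \forall y \near coord c p, P (param c y).
  apply: (rm_param_continuous hM cp); rewrite (rm_coordK hM cp).
  exact: open_nbhs_nbhs.
by apply: filterS2 nE nP => _ [q cq <-]; rewrite (rm_coordK hM cq).
Qed.

Lemma gramU c p : dom c p -> gram c p \in unitmx.
Proof. by move=> cp; apply: gram_unitmx => v; exact: rm_gram_pos. Qed.

Lemma inner_gradient c p f w : dom c p ->
  differentiable (f \o param c) (coord c p) ->
  inner c p (gradient f p c) w = 'D_w (f \o param c) (coord c p).
Proof.
move=> cp df; rewrite /inner /gradient mulmxKV ?gramU// derive_delta// mxE.
by apply: eq_bigr => i _; rewrite !mxE mulrC.
Qed.

Lemma innerC c p v w : dom c p -> inner c p v w = inner c p w v.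
Proof. by move=> cx; apply: mxform_sym; exact: rm_gram_sym. Qed.

Lemma innerZl c p k v w : inner c p (k *: v) w = k * inner c p v w.
Proof. exact: mxformZl. Qed.

Lemma innerZr c p k v w : inner c p v (k *: w) = k * inner c p v w.
Proof. exact: mxformZr. Qed.

Lemma inner_injl c p v v' : dom c p ->
  (forall w, inner c p v w = inner c p v' w) -> v = v'.
Proof.
move=> cp vv'; apply/eqP; rewrite -subr_eq0; apply: contraT.
move=> /(rm_gram_pos hM cp).
rewrite [inner _ _ _ _]mxformDl -scaleN1r mxformZl mulN1r.
have E w : mxform (gram c p) v w = mxform (gram c p) v' w by exact: vv'.
by rewrite E subrr ltxx.
Qed.

Lemma near_coordK c d p : dom c p -> dom d p ->
  \forall y \near coord c p, param d (coord d (param c y)) = param c y.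
Proof.
move=> cp dp.
apply: filterS (near_chart cp (rm_open_dom hM d) dp) => y [_ _ dy].
exact: rm_coordK.
Qed.

Lemma transition_differentiable c d p : dom c p -> dom d p ->
  differentiable (coord d \o param c) (coord c p).
Proof.
by move=> cp dp; have [+ _] := rm_transition hM c d 1%N; apply; exists p.
Qed.

Lemma derive_transport (W : normedModType R) c d p (f : M -> W) w :
  dom c p -> dom d p ->
  differentiable (f \o param d) (coord d p) ->
  'D_w (f \o param c) (coord c p)
  = 'D_(transport c d p w) (f \o param d) (coord d p).
Proof.
move=> cp dp df.
have dT := transition_differentiable cp dp.
have cpE : (coord d \o param c) (coord c p) = coord d p.
  by rewrite /= (rm_coordK hM cp).
rewrite /transport -deriveE// -[in RHS]cpE -derive_comp//; last by rewrite cpE.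
apply: near_eq_derive; apply: filterS (near_coordK cp dp) => y E.
by rewrite /= E.
Qed.

Lemma transportK c d p w : dom c p -> dom d p ->
  transport d c p (transport c d p w) = w.
Proof.
move=> cp dp; have dT := transition_differentiable dp cp.
rewrite {1}/transport -deriveE// -derive_transport//.
rewrite (@near_eq_derive _ _ _ _ id) ?derive_id//.
by apply: filterS (near_chart cp openT I) => y [_ + _].
Qed.

(** Both sides represent the differential of [f]: transport preserves the metric
    and is onto, and derivatives of [f] are compatible with it. *)
Lemma transport_gradient c d p f : dom c p -> dom d p ->
  differentiable (f \o param c) (coord c p) ->
  differentiable (f \o param d) (coord d p) ->
  transport c d p (gradient f p c) = gradient f p d.
Proof.
move=> cp dp dfc dfd; apply: (inner_injl dp) => w.
rewrite -[w in LHS](transportK w dp cp) (rm_gram_transport hM)//.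
by rewrite !inner_gradient// (derive_transport _ dp cp).
Qed.

End Charts.

(** * Coordinates on the product *)

Section Hcons.
Context {R : realType} {n : nat}.
Implicit Types (a b : R) (v w : 'rV[R]_n).

Definition hcons a v : 'rV[R]_(1 + n) := row_mx a%:M v.

Lemma hcons0E a v : hcons a v 0 0 = a.
Proof.
have -> : (0 : 'I_(1 + n)) = lshift n 0 by exact: val_inj.
by rewrite row_mxEl mxE eqxx mulr1n.
Qed.

Lemma rsubmx_hcons a v : rsubmx (hcons a v) = v.
Proof. exact: row_mxKr. Qed.

Lemma hconsK (y : 'rV[R]_(1 + n)) : hcons (y 0 0) (rsubmx y) = y.
Proof.
rewrite -[RHS]hsubmxK; congr row_mx; apply/matrixP => i j.
rewrite !ord1 !mxE eqxx mulr1n; congr (y _ _); exact: val_inj.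
Qed.

Lemma hconsD a b v w : hcons a v + hcons b w = hcons (a + b) (v + w).
Proof. by rewrite /hcons add_row_mx raddfD. Qed.

Lemma hconsZ k a v : k *: hcons a v = hcons (k * a) (k *: v).
Proof. by rewrite /hcons scale_row_mx scale_scalar_mx. Qed.

Lemma hcons_lin a v : hcons a v = a *: hcons 1 0 + v *m row_mx 0 1%:M.
Proof.
rewrite mul_mx_row mulmx0 mulmx1 hconsZ mulr1 scaler0 /hcons add_row_mx.
by rewrite addr0 add0r.
Qed.

Lemma mxform_hcons (B : 'M[R]_n) a b v w :
  mxform (block_mx 1%:M 0 0 B : 'M[R]_(1 + n)) (hcons a v) (hcons b w) =
  a * b + mxform B v w.
Proof.
rewrite /mxform /hcons mul_row_block !mulmx0 mulmx1 addr0 add0r tr_row_mx.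
by rewrite mul_row_col tr_scalar_mx -scalar_mxM !mxE eqxx mulr1n.
Qed.

Context {V : normedModType R}.

Lemma differentiable_hcons (f : V -> R) (g : V -> 'rV[R]_n) x :
  differentiable f x -> differentiable g x ->
  differentiable (fun y => hcons (f y) (g y)) x.
Proof.
move=> df dg; under eq_fun do rewrite hcons_lin.
apply: differentiableD; first exact: differentiableZl.
by apply: differentiable_mulmx => //; exact: differentiable_cst.
Qed.

Lemma derive_hcons (f : V -> R) (g : V -> 'rV[R]_n) (x v : V) :
  differentiable f x -> differentiable g x ->
  'D_v (fun y => hcons (f y) (g y)) x = hcons ('D_v f x) ('D_v g x).
Proof.
move=> df dg; under eq_fun do rewrite hcons_lin.
have df' : differentiable (fun y => f y *: hcons 1 0) x.
  exact: differentiableZl.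
have dg' : differentiable (fun y => g y *m row_mx 0 1%:M : 'rV[R]_(1 + n)) x.
  exact: (@differentiable_mulmx _ _ _ _ _ g (cst _) _ dg
    (differentiable_cst _ _)).
rewrite deriveD; [|exact: diff_derivable..].
rewrite (@derive_mulmx _ _ _ _ _ g (cst _) _ _ dg (differentiable_cst _ _)).
rewrite derive_cst mulmx0 addr0 [RHS]hcons_lin; congr (_ + _).
by rewrite !deriveE// diffZl.
Qed.

Lemma derive_coord (h y : 'rV[R]_(1 + n)) i j :
  'D_h (fun z : 'rV[R]_(1 + n) => z i j) y = h i j.
Proof. by rewrite -(@derive_mxE _ _ _ _ id)// derive_id. Qed.

Lemma derive_rsubmx (h y : 'rV[R]_(1 + n)) :
  'D_h (@rsubmx R 1 1 n) y = rsubmx h.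
Proof.
rewrite deriveE; last exact: differentiable_rsubmx.
by rewrite diff_lin//; exact: continuous_rsubmx.
Qed.

Lemma Ck_hcons k (U : set V) (f : V -> R) (g : V -> 'rV[R]_n) : open U ->
  Ck k U f -> Ck k U g -> Ck k U (fun y => hcons (f y) (g y)).
Proof.
move=> Uo Cf Cg; have Cg' := (Ck_mxP _ _ Uo).1 Cg.
apply/(Ck_mxP _ _ Uo) => i j.
have E y : hcons (f y) (g y) i j =
    match fintype.split j with
    | inl j' => f y *+ (i == j')
    | inr j' => g y i j'
    end.
  by rewrite /hcons mxE; case: (fintype.split j) => j' //; rewrite mxE.
apply: (Ck_eq Uo (fun y _ => esym (E y))).
case: (fintype.split j) => j'; last exact: Cg'.
by case: (i == j'); [exact: Cf|exact: Ck_cst].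
Qed.

Lemma is_derive_comp_rsubmx (Z : normedModType R) (f : 'rV[R]_n -> Z)
    (h y : 'rV[R]_(1 + n)) : differentiable f (rsubmx y) ->
  differentiable (f \o @rsubmx R 1 1 n) y /\
  'D_h (f \o @rsubmx R 1 1 n) y = 'D_(rsubmx h) f (rsubmx y).
Proof.
have dr : differentiable (@rsubmx R 1 1 n) y by exact: differentiable_rsubmx.
move=> df; split; first exact: differentiable_comp.
by rewrite (derive_comp h dr df) derive_rsubmx.
Qed.

Lemma Ck_coord00 k (U : set 'rV[R]_(1 + n)) :
  Ck k U (fun y : 'rV[R]_(1 + n) => y 0 0).
Proof.
apply: (@Ck_affine _ _ _ k U _ (fun h : 'rV[R]_(1 + n) => h 0 0)) => [y|h y].
  exact: differentiable_coord.
exact: derive_coord.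
Qed.

Lemma Ck_comp_rsubmx (Z : normedModType R) k (U : set 'rV[R]_n)
    (f : 'rV[R]_n -> Z) : open U -> Ck k U f ->
  Ck k (@rsubmx R 1 1 n @^-1` U) (f \o @rsubmx R 1 1 n).
Proof.
move=> Uo.
apply: (@Ck_comp_affine _ _ _ _ k U _ (@rsubmx R 1 1 n) f Uo) => [y|h y].
  exact: differentiable_rsubmx.
exact: derive_rsubmx.
Qed.

End Hcons.

(** * The warped product *)

Section Warped.
Context {R : realType} {n : nat} (N : riemannian_data R n) (rho : R -> R).
Local Notation W := (warped_product rho N).
Local Notation coordW c := (@coord R (1 + n) W c).
Local Notation paramW c := (@param R (1 + n) W c).
Local Notation gramW c := (@gram R (1 + n) W c).
Local Notation innerW c := (@inner R (1 + n) W c).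
Implicit Types (c d : chart N) (p q : W).
Local Notation hat c := (coord c @` dom c).

Lemma coord_warped_image c :
  coordW c @` ([set: W] `&` dom (c : chart W))
  = @rsubmx R 1 1 n @^-1` (coord c @` dom c).
Proof.
apply/seteqP; split=> [_ [q [_ cq] <-]|y [x cx xE]] /=.
  by rewrite row_mxKr; exists q.2.
exists (y 0 0, x); first by split.
by rewrite /= xE -[RHS]hconsK.
Qed.

Lemma inner_warped c p a b v w :
  innerW c p (hcons a v) (hcons b w) =
  a * b + rho p.1 ^+ 2 * inner c p.2 v w.
Proof. by rewrite [LHS]mxform_hcons mxformZm. Qed.

Hypothesis hN : is_riemannian_manifold N.
Hypothesis rho_smooth : smooth_on [set: R] rho.

Lemma open_hat c : open (hat c). Proof. exact: rm_open_coord. Qed.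

Lemma open_warped_hat c : open (@rsubmx R 1 1 n @^-1` hat c).
Proof.
by apply: open_comp => [y _|]; [exact: continuous_rsubmx|exact: open_hat].
Qed.

(** Changes of charts of the product are the identity on the first factor; in
    particular the first component of a vector is the same in all charts. *)
Lemma transport_warped c d p a v : dom c p.2 -> dom d p.2 ->
  transport (c : chart W) (d : chart W) p (hcons a v) =
  hcons a (transport c d p.2 v).
Proof.
move=> cp dp; rewrite /transport.
have dT := transition_differentiable hN cp dp.
have cpE : rsubmx (coordW c p) = coord c p.2 by exact: row_mxKr.
have dr : differentiable (@rsubmx R 1 1 n) (coordW c p).
  exact: differentiable_rsubmx.
have dTr :
    differentiable ((coord d \o param c) \o @rsubmx R 1 1 n) (coordW c p).
  by apply: differentiable_comp; rewrite // cpE.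
have d0 : differentiable (fun y : 'rV[R]_(1 + n) => y 0 0) (coordW c p).
  exact: differentiable_coord.
have -> : coordW d \o paramW c = fun y : 'rV[R]_(1 + n) =>
  hcons (y 0 0) (((coord d \o param c) \o @rsubmx R 1 1 n) y) by [].
rewrite -!deriveE//; last exact: differentiable_hcons.
rewrite derive_hcons//; congr hcons; first by rewrite derive_coord hcons0E.
rewrite (derive_comp _ dr) ?cpE// derive_rsubmx rsubmx_hcons//.
Qed.

Lemma rho_differentiable t : differentiable rho t.
Proof. by have [+ _] := rho_smooth 1%N; apply. Qed.

Lemma is_derive_rho_coord (h y : 'rV[R]_(1 + n)) :
  differentiable (fun z : 'rV[R]_(1 + n) => rho (z 0 0)) y /\
  'D_h (fun z : 'rV[R]_(1 + n) => rho (z 0 0)) y = h 0 0 * 'D_1 rho (y 0 0).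
Proof.
have d0 : differentiable (fun z : 'rV[R]_(1 + n) => z 0 0) y.
  exact: differentiable_coord.
split; first exact: (differentiable_comp d0 (rho_differentiable _)).
rewrite (derive_comp h d0 (rho_differentiable _)) derive_coord.
by rewrite derive_scalar//; exact: rho_differentiable.
Qed.

Lemma gram_differentiable c x : dom c x ->
  differentiable (gram c \o param c) (coord c x).
Proof.
by move=> cx; have [+ _] := rm_gram_smooth hN c 1%N; apply; exists x.
Qed.

Lemma differentiable_gram_warped c p : dom c p.2 ->
  differentiable (gramW c \o paramW c) (coordW c p).
Proof.
move=> cp; have [drho _] := is_derive_rho_coord 0 (coordW c p).
have dgr : differentiable (gram c \o param c) (rsubmx (coordW c p)).
  by rewrite row_mxKr; exact: gram_differentiable.
have [dg _] := is_derive_comp_rsubmx 0 dgr.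
have /differentiable_mxP dg' := dg.
apply/differentiable_mxP => i j.
rewrite /=; under eq_fun do rewrite mxE; case: (fintype.split i) => i';
  under eq_fun do rewrite mxE; case: (fintype.split j) => j';
  try exact: differentiable_cst.
under eq_fun do rewrite mxE.
by apply: differentiableM => //; exact: (differentiableX 1).
Qed.

(** The entries that vary are those of [rho ^+ 2] times the metric of [N]; the
    product rule separates the two factors. *)
Lemma derive_gram_warped c p a v b1 x b2 w : dom c p.2 ->
  mxform ('D_(hcons a v) (gramW c \o paramW c)
            (coordW c p)) (hcons b1 x) (hcons b2 w) =
  2 * rho p.1 * 'D_1 rho p.1 * a * inner c p.2 x w
  + rho p.1 ^+ 2 * mxform ('D_v (gram c \o param c) (coord c p.2)) x w.
Proof.
move=> cp; have [drho Drho] := is_derive_rho_coord (hcons a v) (coordW c p).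
have rE : rsubmx (coordW c p) = coord c p.2 by rewrite row_mxKr.
have dgr : differentiable (gram c \o param c) (rsubmx (coordW c p)).
  by rewrite rE; exact: gram_differentiable.
have [dg Dg] := is_derive_comp_rsubmx (hcons a v) dgr.
have dGW := differentiable_gram_warped cp.
have dcst (m : nat) (u : 'rV[R]_m) z :
    differentiable (fun _ : 'rV[R]_(1 + n) => u) z.
  exact: differentiable_cst.
have Dcst (m : nat) (u : 'rV[R]_m) z :
    'D_(hcons a v) (fun _ : 'rV[R]_(1 + n) => u) z = 0.
  exact: derive_cst.
have := derive_mxform (hcons a v) dGW
  (dcst _ (hcons b1 x) _) (dcst _ (hcons b2 w) _).
rewrite !Dcst mxform0l mxform0r !addr0 => <-.
pose r (z : 'rV[R]_(1 + n)) := rho (z 0 0).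
pose g (z : 'rV[R]_(1 + n)) :=
  mxform (((gram c \o param c) \o @rsubmx R 1 1 n) z) x w.
have -> : (fun y => mxform ((gramW c \o paramW c) y)
    (hcons b1 x) (hcons b2 w)) = cst (b1 * b2) + r ^+ 2 * g.
  by apply/funext => y; rewrite [LHS]mxform_hcons mxformZm.
have dgg : differentiable g (coordW c p).
  exact: (differentiable_mxform dg (dcst _ x _) (dcst _ w _)).
have Dgg : 'D_(hcons a v) g (coordW c p) =
    mxform ('D_v (gram c \o param c) (coord c p.2)) x w.
  rewrite (derive_mxform _ dg (dcst _ x _) (dcst _ w _)) !Dcst.
  by rewrite mxform0l mxform0r !addr0 Dg rsubmx_hcons rE.
have dr : differentiable r (coordW c p) by exact: drho.
have dr2 : differentiable (r ^+ 2) (coordW c p) by exact: differentiableX.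
have dr2g : differentiable (r ^+ 2 * g) (coordW c p).
  exact: differentiableM.
have c0 : coordW c p 0 0 = p.1 by exact: hcons0E.
rewrite deriveD; [|exact: derivable_cst|exact: diff_derivable].
rewrite derive_cst add0r deriveM; [|exact: diff_derivable..].
rewrite deriveX; last exact: diff_derivable.
rewrite Dgg Drho hcons0E /r /g /= !c0 rsubmx_hcons.
rewrite (rm_coordK hN cp) -[inner c p.2 x w]/(mxform (gram c p.2) x w).
rewrite /GRing.scale/= fctE expr1 /r /= c0; ring.
Qed.

End Warped.

(** * The graph and its tangent vectors *)

Section Graph.
Context {R : realType} {n : nat} (N : riemannian_data R n) (rho : R -> R)
  (F : N -> R).
Local Notation W := (warped_product rho N).
Local Notation coordW c := (@coord R (1 + n) W c).
Local Notation paramW c := (@param R (1 + n) W c).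
Local Notation S := (graph_of rho F).
Implicit Types (c d : chart N) (p q : W) (x : N) (v w : 'rV[R]_n).
Local Notation hat c := (coord c @` dom c).
Local Notation Fhat c := (F \o param c).
Hypothesis hN : is_riemannian_manifold N.
Hypothesis F_smooth : smooth_fun [set: N] F.

Lemma Fhat_smooth c k : Ck k (hat c) (Fhat c).
Proof. by have := F_smooth c k; rewrite setTI. Qed.

Lemma Fhat_differentiable c x : dom c x -> differentiable (Fhat c) (coord c x).
Proof. by move=> cx; have [+ _] := Fhat_smooth c 1; apply; exists x. Qed.

Lemma derive_height c (h y : 'rV[R]_(1 + n)) :
  differentiable (Fhat c) (rsubmx y) ->
  'D_h (fun z : 'rV[R]_(1 + n) => z 0 0 - Fhat c (rsubmx z)) y
  = h 0 0 - 'D_(rsubmx h) (Fhat c) (rsubmx y).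
Proof.
move=> dF; have [dFr DFr] := is_derive_comp_rsubmx h dF.
have d0 : differentiable (fun z : 'rV[R]_(1 + n) => z 0 0) y.
  exact: differentiable_coord.
by rewrite deriveB ?derive_coord ?DFr//; exact: diff_derivable.
Qed.

Lemma height_smooth c k : Ck k (@rsubmx R 1 1 n @^-1` hat c)
  (fun y : 'rV[R]_(1 + n) => y 0 0 - Fhat c (rsubmx y)).
Proof.
have Uo : open (@rsubmx R 1 1 n @^-1` hat c) by exact: open_warped_hat.
have CF := Ck_comp_rsubmx (@open_hat _ _ _ hN c) (@Fhat_smooth c k).
have CN1 := @Ck_cst _ _ R k (@rsubmx R 1 1 n @^-1` hat c) (-1).
apply: (Ck_eq Uo _ (CkD Uo (Ck_coord00 k _) (CkM Uo CN1 CF))).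
by move=> y _; rewrite /= !fctE mulN1r.
Qed.

Lemma height_differential c p : dom c p.2 ->
  differential (c : chart W) (fun q : W => q.1 - F q.2) p != 0.
Proof.
move=> cp; apply/eqP => /rowP/(_ 0); rewrite !mxE /pderiv.
have dF : differentiable (Fhat c) (rsubmx (coordW c p)).
  by rewrite row_mxKr; exact: Fhat_differentiable.
have := derive_height (delta_mx 0 0) dF.
have -> : rsubmx (delta_mx 0 0 : 'rV[R]_(1 + n)) = 0.
  by apply/rowP => j; rewrite !mxE.
by rewrite derive0 subr0 mxE /= => -> /eqP; rewrite oner_eq0.
Qed.

(** The graph is the zero set of [t - F x], whose derivative along [d/dt] is
    1. *)
Lemma hypersurface_graph : hypersurface S.
Proof.
move=> p Sp; exists setT, (fun q : W => q.1 - F q.2); split=> //.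
- exact: openT.
- by move=> c k; rewrite coord_warped_image; exact: height_smooth.
- by move=> q c _ cq; exact: height_differential.
- rewrite setIT; apply/seteqP.
  split=> [_ [x _ <-]|[t x] [_ /= /subr0_eq ->]] /=.
    by rewrite subrr.
  by exists x.
Qed.

Definition graph_param c (y : 'rV[R]_n) : 'rV[R]_(1 + n) := hcons (Fhat c y) y.

Lemma param_graph_param c y :
  paramW c (graph_param c y) = (F (param c y), param c y).
Proof. by rewrite /= /graph_param hcons0E rsubmx_hcons. Qed.

Lemma coord_graph c p : S p -> dom c p.2 ->
  coordW c p = graph_param c (coord c p.2).
Proof. by move=> [x _ <-] /= cx; rewrite /graph_param /= (rm_coordK hN cx). Qed.

Lemma graphE p : S p -> p.1 = F p.2.
Proof. by move=> [x _ <-]. Qed.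

Lemma graph_param_in_graph c y : S (paramW c (graph_param c y)).
Proof. by rewrite param_graph_param; exists (param c y). Qed.

Lemma is_derive_graph_param c x w : dom c x ->
  differentiable (graph_param c) (coord c x) /\
  'D_w (graph_param c) (coord c x) = hcons ('D_w (Fhat c) (coord c x)) w.
Proof.
move=> cx; have dF := Fhat_differentiable cx.
have di : differentiable id (coord c x) by exact: ex_diff.
split; first exact: differentiable_hcons.
by rewrite /graph_param derive_hcons// derive_id.
Qed.

Lemma tangent_graphE c p (h : 'rV[R]_(1 + n)) : S p -> dom c p.2 ->
  tangent S (c : chart W) p h ->
  h = hcons ('D_(rsubmx h) (Fhat c) (coord c p.2)) (rsubmx h).
Proof.
move=> Sp cp [g [e [e0 g0 gS gsm gD]]].
have [dg _] := gsm 1%N.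
have {}dg := dg 0 (eq_ind_r (fun z => z < e) e0 (normr0 _)).
set G := coordW c \o g in dg gD *.
have rG0 : rsubmx (G 0) = coord c p.2 by rewrite /G /= g0 row_mxKr.
have dr : differentiable (@rsubmx R 1 1 n) (G 0).
  exact: differentiable_rsubmx.
have drG : differentiable (@rsubmx R 1 1 n \o G) 0.
  exact: differentiable_comp.
have DrG : 'D_1 (@rsubmx R 1 1 n \o G) 0 = rsubmx h.
  by rewrite (@derive_comp _ _ _ _ _ _ _ (1 : R) dg dr) derive_rsubmx gD.
have [dG DG] := is_derive_graph_param (rsubmx h) cp.
have dG' : differentiable (graph_param c) ((@rsubmx R 1 1 n \o G) 0).
  by rewrite [X in differentiable _ X]rG0.
rewrite -DG -[X in 'D_X _ _]DrG -rG0.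
rewrite -(@derive_comp _ _ _ _ _ _ _ (1 : R) drG dG') -gD.
apply: near_eq_derive.
have : \forall s \near (0 : R), `|s| < e by exact: nbhs0_lt.
apply: filterS => s /gS[Sgs cgs].
have E : G s = graph_param c (coord c (g s).2) := coord_graph Sgs cgs.
by rewrite [RHS]/= E rsubmx_hcons.
Qed.

(** Lift a coordinate line of [N] to the graph. *)
Lemma tangent_graph c p w : S p -> dom c p.2 ->
  tangent S (c : chart W) p (hcons ('D_w (Fhat c) (coord c p.2)) w).
Proof.
move=> Sp cp; pose l (s : R) := s *: w + coord c p.2.
have [dl0 _] := is_diff_line w (coord c p.2) 0.
have [e e0 eP] : exists2 e : R, 0 < e & forall s, `|s| < e -> hat c (l s).
  have : \forall y \near coord c p.2, hat c y.
    by apply: open_nbhs_nbhs; split; [exact: open_hat|exists p.2].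
  move=> /(near_parallelogram w 0)[e e0 eP]; exists e => // s se.
  by have := eP s 0 (ltW se); rewrite normr0 scaler0 add0r; apply; exact: ltW.
have hatK y : hat c y -> coord c (param c y) = y /\ dom c (param c y).
  by move=> [x cx <-]; rewrite (rm_coordK hN cx).
have E s : `|s| < e -> coordW c (paramW c (graph_param c (l s)))
    = graph_param c (l s).
  move=> /eP/hatK[lK cl]; rewrite coord_graph ?param_graph_param//= ?lK//.
  by exists (param c (l s)).
have eo : open [set s : R | `|s| < e].
  rewrite (_ : [set _ | _] = ball (0 : R) e); first exact: ball_open.
  rewrite -ball_normE; apply/seteqP.
  by split=> s; rewrite /ball_/= sub0r normrN.
have l0 : l 0 = coord c p.2 by rewrite /l scale0r add0r.
exists (fun s => paramW c (graph_param c (l s))), e; split=> //.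
- rewrite l0 param_graph_param (rm_coordK hN cp).
  by rewrite [RHS]surjective_pairing (graphE Sp).
- move=> s /eP/hatK[_ cl]; split; first exact: graph_param_in_graph.
  by rewrite param_graph_param.
- move=> k; have Ck_gp : Ck k (hat c) (graph_param c).
    apply: Ck_hcons; [exact: open_hat|exact: Fhat_smooth|].
    apply: (@Ck_affine _ _ _ k _ id id) => [y|v y]; first exact: ex_diff.
    exact: derive_id.
  have Cl : Ck k (l @^-1` hat c) (graph_param c \o l).
    apply: (@Ck_comp_affine _ _ _ _ k _ l (fun s => s *: w)) => [|t|s t|].
    + exact: open_hat.
    + by have [] := is_diff_line w (coord c p.2) t.
    + exact: derive_line.
    + exact: Ck_gp.
  apply: (Ck_eq eo _ (Ck_sub (fun s => eP s) Cl)) => s.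
  rewrite inE => se.
  by rewrite -[RHS]/(coordW c (paramW c (graph_param c (l s)))) E.
- have [dG DG] := is_derive_graph_param w cp.
  rewrite -DG -l0.
  have dG' : differentiable (graph_param c) (l 0) by rewrite l0.
  transitivity ('D_1 (graph_param c \o l) 0).
    apply: near_eq_derive.
    have : \forall s \near (0 : R), `|s| < e by exact: nbhs0_lt.
    by apply: filterS => s; exact: E.
  by rewrite (@derive_comp _ _ _ _ _ _ _ (1 : R) dl0 dG') derive_line scale1r.
Qed.

End Graph.

(** * Transnormal functions *)

Section Transnormal.
Context {R : realType} {n : nat} (N : riemannian_data R n) (F : N -> R).
Implicit Types (c d : chart N) (x : N) (v w : 'rV[R]_n).
Local Notation hat c := (coord c @` dom c).
Local Notation Fhat c := (F \o param c).
Hypothesis hN : is_riemannian_manifold N.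
Hypothesis F_smooth : smooth_fun [set: N] F.

Lemma Ck_gradient c k : Ck k (hat c) (fun y => gradient F (param c y) c).
Proof.
have Uo := @open_hat _ _ _ hN c.
apply: Ck_mulmx => //.
  apply/(Ck_mxP _ _ Uo) => i j.
  have [_ /(_ (delta_mx 0 j))] := @Fhat_smooth _ _ _ _ F_smooth c k.+1.
  apply: Ck_eq => // y; rewrite inE => -[x cx <-].
  by rewrite mxE /pderiv (rm_coordK hN cx).
apply: Ck_invmx => //; last exact: rm_gram_smooth.
by move=> _ [x cx <-]; rewrite (rm_coordK hN cx); exact: gramU.
Qed.

(* This is transnormality, with [B] the square of the function [b] in its
   definition. *)
Variable B : R -> R.
Hypothesis B_F : forall x c, dom c x ->
  inner c x (gradient F x c) (gradient F x c) = B (F x).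

Lemma Ck_sqr_gradient c k : Ck k (hat c) (B \o Fhat c).
Proof.
have Uo := @open_hat _ _ _ hN c.
apply: (Ck_eq Uo _ (Ck_mxform Uo (rm_gram_smooth hN c k) (Ck_gradient c k)
  (Ck_gradient c k))).
move=> _ /set_mem[x cx <-].
by rewrite /= [LHS]B_F (rm_coordK hN cx).
Qed.

(** Half the derivative of the squared norm of the gradient is the Hessian
    applied to the gradient.  In coordinates: differentiating the pairing of the
    gradient with a fixed vector [z], which is [ 'D_z (Fhat c) ], expresses the
    derivative of the gradient field through second derivatives of [F] and first
    derivatives of the metric; the Hessian comes out as [ 'D_w 'D_f ] and is
    turned into [ 'D_f 'D_w ], the order in which it arises from
    [local_extension_derive]. *)
Lemma derive_sqr_gradient c x w : dom c x ->
  let f := gradient F x c in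
  'D_w (B \o Fhat c) (coord c x) =
  2 * 'D_f (fun y => 'D_w (Fhat c) y) (coord c x)
  - mxform ('D_w (gram c \o param c) (coord c x)) f f.
Proof.
move=> cx f; set y0 := coord c x; have hy0 : hat c y0 by exists x.
have Uo := @open_hat _ _ _ hN c.
have dg := gram_differentiable hN cx.
pose G y := gradient F (param c y) c.
have dG : differentiable G y0 by have [+ _] := Ck_gradient c 1; apply.
have G0 : G y0 = f by rewrite /G (rm_coordK hN cx).
have nh : \forall y \near y0, hat c y by exact: open_nbhs_nbhs.
have GE z : \forall y \near y0,
    mxform ((gram c \o param c) y) (G y) z = 'D_z (Fhat c) y.
  apply: filterS nh => _ [x' cx' <-].
  rewrite [LHS]inner_gradient ?(rm_coordK hN cx')//.
  exact: Fhat_differentiable.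
have dcst (z : 'rV[R]_n) : differentiable (fun _ : 'rV[R]_n => z) y0.
  exact: differentiable_cst.
have E z : 'D_w (fun y => 'D_z (Fhat c) y) y0 =
    mxform ('D_w (gram c \o param c) y0) f z + mxform (gram c x) ('D_w G y0) z.
  rewrite -(near_eq_derive w (GE z)) (derive_mxform w dg dG (dcst z)).
  by rewrite derive_cst mxform0r addr0 G0 /= (rm_coordK hN cx).
rewrite (derive_comm _ _ Uo hy0 (@Fhat_smooth _ _ _ _ F_smooth c 2)) E.
rewrite -(near_eq_derive
  (f := fun y => mxform ((gram c \o param c) y) (G y) (G y))); last first.
  apply: filterS nh => _ [x' cx' <-].
  by rewrite [LHS]B_F/= (rm_coordK hN cx').
rewrite (derive_mxform w dg dG dG) G0 /= (rm_coordK hN cx).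
rewrite [mxform (gram c x) f _]mxform_sym ?(rm_gram_sym hN cx)//; ring.
Qed.

Hypothesis gradF_neq0 : forall x c, dom c x -> gradient F x c != 0.

(** Along the coordinate line through [x] in the direction of the gradient [f],
    [F] has derivative [inner f f > 0] at [x], and [B \o F] is smooth. *)
Lemma derivable_B x : derivable B (F x) 1.
Proof.
have [c cx] := rm_cover hN x; set f := gradient F x c.
set y0 := coord c x; have hy0 : hat c y0 by exists x.
pose l (s : R) := s *: f + y0.
have l0 : l 0 = y0 by rewrite /l scale0r add0r.
have cl : {for 0, continuous l}.
  by apply: differentiable_continuous; have [] := is_diff_line f y0 0.
have nh : \forall s \near (0 : R), hat c (l s).
  by apply: cl; rewrite l0; apply: open_nbhs_nbhs; split => //; exact: open_hat.
have [dF dDF] := @Fhat_smooth _ _ _ _ F_smooth c 1.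
pose phi s := Fhat c (l s).
have phi0 : phi 0 = F x by rewrite /phi l0 /= (rm_coordK hN cx).
have dphi s : hat c (l s) -> is_derive s 1 phi ('D_f (Fhat c) (l s)).
  by move=> /dF; exact: is_derive_along.
rewrite -phi0; apply: (@derivable_along_diffeo _ B phi).
- by apply: filterS nh => s /dphi[/derivable1_diffP].
- have cDF : {for 0, continuous (fun s => 'D_f (Fhat c) (l s))}.
    have cDf : {for l 0, continuous (fun y => 'D_f (Fhat c) y)}.
      by rewrite l0; exact: dDF.
    exact: (@continuous_comp _ _ _ l (fun y => 'D_f (Fhat c) y) 0 cl cDf).
  have E : \forall s \near (0 : R), 'D_f (Fhat c) (l s) = 'D_1 phi s.
    by apply: filterS nh => s /dphi[_ ->].
  suff: 'D_1 phi s @[s --> (0 : R)] --> 'D_1 phi 0 by [].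
  rewrite -(nbhs_singleton E).
  by apply: cvg_trans cDF; apply: near_eq_cvg.
- have [_ ->] := dphi 0 (eq_ind_r (hat c) hy0 l0).
  rewrite l0 -inner_gradient//; last by apply: dF.
  by rewrite gt_eqF// (rm_gram_pos hN cx)// gradF_neq0.
- have [dBF _] := Ck_sqr_gradient c 1.
  apply/derivable1_diffP.
  apply: (differentiable_comp (f := l) (g := B \o Fhat c)).
    by have [] := is_diff_line f y0 0.
  by rewrite l0; apply: dBF.
Qed.

Lemma derive_B_F c x w : dom c x ->
  'D_w (B \o Fhat c) (coord c x) = 'D_1 B (F x) * 'D_w (Fhat c) (coord c x).
Proof.
move=> cx; have dF := Fhat_differentiable F_smooth cx.
have dB : differentiable B (Fhat c (coord c x)).
  by rewrite /= (rm_coordK hN cx); apply/derivable1_diffP; exact: derivable_B.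
by rewrite (derive_comp w dF dB) derive_scalar// mulrC /= (rm_coordK hN cx).
Qed.

End Transnormal.

(** * Unit normals of the graph and their covariant derivative *)

Section Curvature.
Context {R : realType} {n : nat} (N : riemannian_data R n) (rho : R -> R)
  (F : N -> R).
Local Notation W := (warped_product rho N).
Local Notation coordW c := (@coord R (1 + n) W c).
Local Notation paramW c := (@param R (1 + n) W c).
Local Notation gramW c := (@gram R (1 + n) W c).
Local Notation innerW c := (@inner R (1 + n) W c).
Local Notation S := (graph_of rho F).
Implicit Types (c d : chart N) (p q : W) (x : N) (v w : 'rV[R]_n).
Local Notation hat c := (coord c @` dom c).
Local Notation Fhat c := (F \o param c).
Hypothesis hN : is_riemannian_manifold N.
Hypothesis rho_smooth : smooth_on [set: R] rho.
Hypothesis rho_pos : forall t, 0 < rho t.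
Hypothesis F_smooth : smooth_fun [set: N] F.
Variable B : R -> R.
Hypothesis B_F : forall x c, dom c x ->
  inner c x (gradient F x c) (gradient F x c) = B (F x).
Hypothesis gradF_neq0 : forall x c, dom c x -> gradient F x c != 0.

Lemma B_gt0 x : 0 < B (F x).
Proof.
have [c cx] := rm_cover hN x.
by rewrite -(B_F cx) (rm_gram_pos hN)// gradF_neq0.
Qed.

Lemma gram_warped_sym c p : dom c p.2 ->
  (gramW c p)^T = gramW c p.
Proof.
move=> cp; rewrite /= tr_block_mx trmx1 !trmx0 linearZ/= (rm_gram_sym hN cp).
by [].
Qed.

Lemma gram_warped_pos c p (h : 'rV[R]_(1 + n)) : dom c p.2 -> h != 0 ->
  0 < innerW c p h h.
Proof.
move=> cp; rewrite -(hconsK h) inner_warped => h0.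
have r2 : 0 < rho p.1 ^+ 2 by rewrite exprn_gt0.
have [z0|z0] := eqVneq (rsubmx h) 0.
  rewrite z0 in h0 *; rewrite [inner _ _ _ _]mxform0l mulr0 addr0 -expr2.
  rewrite lt0r sqr_ge0 andbT sqrf_eq0; apply: contraNneq h0 => ->.
  by rewrite /hcons raddf0 row_mx0.
by rewrite ltr_wpDl ?mulr_gt0 ?(rm_gram_pos hN cp)// -expr2 sqr_ge0.
Qed.

Lemma inner_warpedC c p (h k : 'rV[R]_(1 + n)) : dom c p.2 ->
  innerW c p h k = innerW c p k h.
Proof. by move=> cp; apply: mxform_sym; exact: gram_warped_sym. Qed.

Section Normal.
Variable xi : vector_field W.
Hypothesis xi_normal : unit_normal S xi.

Lemma normal_orth c p w : S p -> dom c p.2 ->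
  innerW c p (xi p c) (hcons ('D_w (Fhat c) (coord c p.2)) w) = 0.
Proof.
move=> Sp cp; rewrite inner_warpedC//.
have [_ /(_ p c Sp cp)[_]] := xi_normal; apply.
exact: tangent_graph.
Qed.

Lemma normal_norm c p : S p -> dom c p.2 ->
  innerW c p (xi p c) (xi p c) = 1.
Proof.
move=> Sp cp; have [_ /(_ p c Sp cp)[+ _]] := xi_normal.
rewrite /gnorm; set t := inner _ _ _ _ => t1.
have t0 : 0 <= t.
  rewrite leNgt; apply/negP => /ltW/ler0_sqrtr; rewrite t1 => /eqP.
  by rewrite oner_eq0.
by rewrite -(sqr_sqrtr t0) t1 expr1n.
Qed.

(** Orthogonality to the vectors [(dF w, w)] says that the second component,
    scaled by [rho ^+ 2], represents minus the first component times [dF]. *)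
Lemma unit_normalE c p : S p -> dom c p.2 ->
  xi p c =
  hcons (xi p c 0 0) (- (xi p c 0 0 / rho p.1 ^+ 2) *: gradient F p.2 c).
Proof.
move=> Sp cp; rewrite -[LHS]hconsK; congr hcons; apply: (inner_injl hN cp) => w.
have O := normal_orth w Sp cp; rewrite -(hconsK (xi p c)) inner_warped in O.
rewrite innerZl inner_gradient//; last exact: Fhat_differentiable.
have r0 : rho p.1 ^+ 2 != 0 by rewrite expf_neq0// gt_eqF.
move/eqP: O; rewrite addrC addr_eq0 => /eqP E.
by apply: (mulfI r0); rewrite E mulrA mulrN mulrCA divff// mulr1 mulNr.
Qed.

Lemma sqr_normal_height c p : S p -> dom c p.2 ->
  xi p c 0 0 ^+ 2 * (rho p.1 ^+ 2 + B (F p.2)) = rho p.1 ^+ 2.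
Proof.
move=> Sp cp; have E := normal_norm Sp cp.
rewrite (unit_normalE Sp cp) inner_warped in E.
rewrite innerZl innerZr (B_F cp) in E.
have r0 : rho p.1 != 0 by rewrite gt_eqF.
rewrite -[RHS]mulr1 -E; field. exact: r0.
Qed.

(** The derivatives along [V] of the two identities that hold on the graph: [xi]
    is orthogonal to [(dF w, w)] and has norm 1.  They are differentiated after
    composition with [graph_param], because [Xi] is known to agree with [xi]
    only on the graph; [V] is the image of [v] under this parametrization, so that
    derivatives along [V] are the ones obtained.  The Hessian of [F] comes from
    the moving tangent vector. *)
Lemma local_extension_derive c p (U : set W) (Xi : vector_field W) v w :
  S p -> dom c p.2 -> local_extension S xi p U Xi ->
  let V := hcons ('D_v (Fhat c) (coord c p.2)) v in
  let Y := hcons ('D_w (Fhat c) (coord c p.2)) w in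
  let DX := 'D_V (fun y => Xi (paramW c y) c) (coordW c p) in
  let DG := 'D_V (gramW c \o paramW c) (coordW c p) in
  innerW c p DX Y =
    - mxform DG (xi p c) Y
    - xi p c 0 0 * 'D_v (fun y => 'D_w (Fhat c) y) (coord c p.2) /\
  innerW c p DX (xi p c) = - 2^-1 * mxform DG (xi p c) (xi p c).
Proof.
move=> Sp cp [Uo Up [_ Xi_smooth] XiE] V Y DX DG.
set y0 := coord c p.2; have hy0 : hat c y0 by exists p.2.
set Y0 := coordW c p.
have Y0E : Y0 = graph_param F c y0 by exact: coord_graph.
have pK : paramW c Y0 = p.
  rewrite Y0E param_graph_param (rm_coordK hN cp) -(graphE Sp).
  by rewrite -surjective_pairing.
pose G := gramW c \o paramW c.
pose X y := Xi (paramW c y) c.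
have X0 : X Y0 = xi p c by rewrite /X pK; apply: XiE.
have dG : differentiable G Y0 by exact: differentiable_gram_warped.
have dX : differentiable X Y0.
  by have [+ _] := Xi_smooth c 1%N; apply; exists p.
have [dgp Dgp] := is_derive_graph_param F_smooth v cp.
rewrite -/y0 in dgp Dgp.
have Xgp0 : X (graph_param F c y0) = xi p c by rewrite -Y0E.
have dG' : differentiable G (graph_param F c y0) by rewrite -Y0E.
have dX' : differentiable X (graph_param F c y0) by rewrite -Y0E.
have dGgp : differentiable (G \o graph_param F c) y0.
  exact: (@differentiable_comp _ _ _ _ (graph_param F c) G y0 dgp dG').
have dXgp : differentiable (X \o graph_param F c) y0.
  exact: (@differentiable_comp _ _ _ _ (graph_param F c) X y0 dgp dX').
have DGgp : 'D_v (G \o graph_param F c) y0 = DG.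
  by rewrite (@derive_comp _ _ _ _ (graph_param F c) G y0 v dgp dG') Dgp -Y0E.
have DXgp : 'D_v (X \o graph_param F c) y0 = DX.
  by rewrite (@derive_comp _ _ _ _ (graph_param F c) X y0 v dgp dX') Dgp -Y0E.
(* The graph points near [p] lie in [U], where [Xi] extends [xi]. *)
have near_p : \forall y \near y0, xi (paramW c (graph_param F c y)) c
    = X (graph_param F c y) /\ dom c (param c y) /\ coord c (param c y) = y.
  have cgp : (fun y => paramW c (graph_param F c y)) @ y0 --> p.
    rewrite -[p in X in _ --> X]pK Y0E.
    under eq_fun do rewrite param_graph_param.
    have cF := differentiable_continuous (Fhat_differentiable F_smooth cp).
    have cP := rm_param_continuous hN cp.
    by rewrite param_graph_param; exact: (cvg_pair cF cP).
  have nU : \forall y \near y0, U (paramW c (graph_param F c y)).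
    have oU := open_nbhs_nbhs (conj Uo Up).
    exact: cgp U oU.
  have nc := near_chart hN cp openT I.
  apply: filterS2 nU nc => y Uy [cy yK _].
  split; last by split.
  have cy' : dom (c : chart W) (paramW c (graph_param F c y)).
    by rewrite param_graph_param.
  by rewrite /X (XiE _ _ (graph_param_in_graph rho F c y) Uy cy').
have dcw z : differentiable (fun _ : 'rV[R]_n => z : 'rV[R]_n) y0.
  exact: differentiable_cst.
have dDF : differentiable (fun y => 'D_w (Fhat c) y) y0.
  have [_ C2] := @Fhat_smooth _ _ _ _ F_smooth c 2; have [dD _] := C2 w.
  exact: dD y0 hy0.
pose Yh (y : 'rV[R]_n) := hcons ('D_w (Fhat c) y) w.
have dYh : differentiable Yh y0 := differentiable_hcons dDF (dcw w).
have DYh : 'D_v Yh y0 = hcons ('D_v (fun y => 'D_w (Fhat c) y) y0) 0.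
  by rewrite /Yh (derive_hcons v dDF (dcw w)) derive_cst.
have near_S : \forall y \near y0, [/\ S (paramW c (graph_param F c y)),
    dom c (paramW c (graph_param F c y)).2 &
    coord c (paramW c (graph_param F c y)).2 = y].
  apply: filterS near_p => y [_ [cy yK]].
  split; [exact: graph_param_in_graph| |]; rewrite param_graph_param.
    exact: cy.
  exact: yK.
have nO : \forall y \near y0, mxform ((G \o graph_param F c) y)
    ((X \o graph_param F c) y) (Yh y) = cst 0 y.
  apply: filterS2 near_p near_S => y [XE _] [Sy cy yK].
  have O := normal_orth w Sy cy.
  rewrite yK XE in O; exact: O.
have nN : \forall y \near y0, mxform ((G \o graph_param F c) y)
    ((X \o graph_param F c) y) ((X \o graph_param F c) y) = cst 1 y.
  apply: filterS2 near_p near_S => y [XE _] [Sy cy _].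
  have O := normal_norm Sy cy.
  rewrite XE in O; exact: O.
have DE1 := etrans (near_eq_derive v nO) (derive_cst _ _ _).
have DE2 := etrans (near_eq_derive v nN) (derive_cst _ _ _).
have G0 : G Y0 = gramW c p := congr1 (gramW c) pK.
have GE : (G \o graph_param F c) y0 = gramW c p by rewrite -G0 Y0E.
rewrite (derive_mxform v dGgp dXgp dYh) in DE1.
rewrite DGgp DXgp DYh GE [(X \o _) y0]Xgp0 in DE1.
rewrite (derive_mxform v dGgp dXgp dXgp) in DE2.
rewrite DGgp DXgp GE [(X \o _) y0]Xgp0 in DE2.
split.
  have E :
      innerW c p (xi p c) (hcons ('D_v (fun y => 'D_w (Fhat c) y) y0) 0)
      = xi p c 0 0 * 'D_v (fun y => 'D_w (Fhat c) y) y0.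
    rewrite -[xi p c in LHS]hconsK inner_warped.
    by rewrite [inner c p.2 _ 0]mxform0r mulr0 addr0.
  rewrite -E; apply/eqP; rewrite -subr_eq0 opprD opprK addrA -DE1; apply/eqP.
  by rewrite opprK [mxform _ _ _ + _]addrC.
have {}DE2 : mxform DG (xi p c) (xi p c) + innerW c p DX (xi p c)
  + innerW c p (xi p c) DX = 0 := DE2.
rewrite [inner _ _ (xi p c) _](inner_warpedC _ _ cp) in DE2.
set s := inner _ _ _ _ in DE2 *; set m := mxform _ _ _ in DE2 *.
lra.
Qed.

Lemma tangential_partE c p : S p -> dom c p.2 ->
  tangential_part xi (partial_t rho N) p c =
  (rho p.1 ^+ 2 + B (F p.2))^-1 *: hcons (B (F p.2)) (gradient F p.2 c).
Proof.
move=> Sp cp; rewrite /tangential_part -[partial_t rho N p c]/(hcons 1 0).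
have E := unit_normalE Sp cp.
have H := sqr_normal_height Sp cp.
move: E H; set a := xi p c 0 0; set u := B _; set f := gradient _ _ _.
move=> E H.
have u0 : 0 < u by exact: B_gt0.
have r0 : 0 < rho p.1 by [].
have D0 : rho p.1 ^+ 2 + u != 0 by rewrite gt_eqF// addr_gt0// exprn_gt0.
have A2 : a ^+ 2 = rho p.1 ^+ 2 / (rho p.1 ^+ 2 + u).
  by apply: (mulIf D0); rewrite H divfK.
rewrite E inner_warped [inner c _ 0 _]mxform0l mulr0 addr0 mul1r.
rewrite -scaleN1r !hconsZ hconsD; congr hcons.
  rewrite mulN1r -expr2 A2; field. exact: D0.
rewrite add0r !scalerA; congr (_ *: _).
transitivity (a ^+ 2 / rho p.1 ^+ 2); first by field; rewrite gt_eqF.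
by rewrite A2; field; rewrite D0 gt_eqF.
Qed.

(** The curvature in the direction of the tangential part of [d/dt], as a
    function of the point and of the first component [a] of the unit normal:
    no chart enters. *)
Definition principal_curvature (p : W) (a : R) : R :=
  - (a / (rho p.1 ^+ 2 + B (F p.2)) *
     (2 * ('D_1 rho p.1 / rho p.1) * B (F p.2) + rho p.1 * 'D_1 rho p.1
      - 'D_1 B (F p.2) / 2)).

Lemma covariant_derivative_tangential c p (U : set W) (Xi : vector_field W) :
  S p -> dom c p.2 -> local_extension S xi p U Xi ->
  let T := tangential_part xi (partial_t rho N) p c in
  - covariant_derivative (c : chart W) p T Xi =
  principal_curvature p (xi p c 0 0) *: T.
Proof.
move=> Sp cp ext T.
have TE : T =
    (rho p.1 ^+ 2 + B (F p.2))^-1 *: hcons (B (F p.2)) (gradient F p.2 c).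
  exact: tangential_partE.
clearbody T.
have E := unit_normalE Sp cp.
have H := sqr_normal_height Sp cp.
have XiE : Xi p c = xi p c by case: ext => _ Up _; apply.
rewrite /principal_curvature.
set a := xi p c 0 0 in E H *; set u := B _ in TE H *.
set f := gradient _ _ _ in TE E; set r := rho p.1 in TE E H *.
set r' := 'D_1 rho _; set mu := 'D_1 B _.
set kappa := (_ + _)^-1 in TE *.
have dF := Fhat_differentiable F_smooth cp.
have DFf : 'D_f (Fhat c) (coord c p.2) = u.
  by rewrite -inner_gradient// B_F.
(* [T] is the tangent vector over [kappa *: f]. *)
have V : T = hcons ('D_(kappa *: f) (Fhat c) (coord c p.2)) (kappa *: f).
  by rewrite deriveZv// DFf TE hconsZ.
have rp : 0 < r by exact: rho_pos.
have r0 : r != 0 by rewrite gt_eqF.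
have D0 : r ^+ 2 + u != 0.
  by rewrite gt_eqF// addr_gt0 ?exprn_gt0//; exact: B_gt0.
have a0 : a != 0.
  apply: contra_eq_neq H => ->; rewrite expr0n mul0r eq_sym.
  exact: expf_neq0.
have dG := differentiable_gram_warped hN rho_smooth cp.
have gs := gram_warped_sym cp.
have gp (h : 'rV[R]_(1 + n)) : h != 0 -> 0 < innerW c p h h.
  exact: gram_warped_pos.
have Chr (w : 'rV[R]_(1 + n)) := inner_christoffel gs gp T (Xi p c) w dG.
set cov := covariant_derivative _ _ _ _.
pose DX := 'D_T (fun y => Xi (paramW c y) c) (coordW c p).
pose DG (v : 'rV[R]_(1 + n)) := 'D_v (gramW c \o paramW c) (coordW c p).
have covE (w : 'rV[R]_(1 + n)) : innerW c p cov w = innerW c p DX w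
    + 2^-1 * (mxform (DG T) (xi p c) w + mxform (DG (xi p c)) T w
              - mxform (DG w) T (xi p c)).
  by rewrite -XiE /DG -Chr; exact: mxformDl.
have LED w : innerW c p DX (hcons ('D_w (Fhat c) (coord c p.2)) w) =
    - mxform (DG T) (xi p c) (hcons ('D_w (Fhat c) (coord c p.2)) w)
    - a * 'D_(kappa *: f) (fun y => 'D_w (Fhat c) y) (coord c p.2) /\
  innerW c p DX (xi p c) = - 2^-1 * mxform (DG T) (xi p c) (xi p c).
  rewrite /DX /DG V.
  exact: (local_extension_derive (kappa *: f) w Sp cp ext).
have DGE (v : 'rV[R]_(1 + n)) :
  DG v = 'D_v (gramW c \o paramW c) (coordW c p) by [].
clearbody cov DX DG.
have innerB (k : R) (w : 'rV[R]_(1 + n)) : innerW c p (cov - k *: T) w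
    = innerW c p cov w - k * innerW c p T w.
  by rewrite -scaleNr [LHS]mxformDl mxformZl mulNr.
(* The defect [h] is orthogonal to [xi], hence is itself tangent, and it is
   orthogonal to all tangent vectors. *)
pose h := cov - (a * kappa * (2 * (r' / r) * u + r * r' - mu / 2)) *: T.
suff h0 : h = 0 by move/subr0_eq: h0 => ->; rewrite -scaleNr.
have hxi : innerW c p h (xi p c) = 0.
  have [_ LX] := LED 0.
  have TX : innerW c p T (xi p c) = 0.
    rewrite V inner_warpedC//; exact: normal_orth.
  rewrite /h innerB TX mulr0 subr0 covE LX.
  move: (mxform (DG T) _ _) (mxform (DG _) T _) => m1 m2; ring.
have TE' : T = hcons (kappa * u) (kappa *: f) by rewrite TE hconsZ.
pose Dg v := 'D_v (gram c \o param c) (coord c p.2).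
have DgZ k v : Dg (k *: v) = k *: Dg v.
  by rewrite /Dg deriveZv//; exact: gram_differentiable.
have DgE v : 'D_v (gram c \o param c) (coord c p.2) = Dg v by [].
clearbody Dg.
(* [w0], the pairing of [T] with the tangent vector over [w], is also the
   first component of that vector.  In [e1], [e2] and [e3] the derivatives of
   the metric of [N] along [f] cancel, and [s2] trades its derivative along [w]
   together with the Hessian for [mu * w0]. *)
have hT w : innerW c p h (hcons ('D_w (Fhat c) (coord c p.2)) w) = 0.
  set w0 := 'D_w (Fhat c) (coord c p.2).
  have fw : inner c p.2 f w = w0 by exact: inner_gradient.
  have ff : inner c p.2 f f = u by exact: B_F.
  have [LY _] := LED w.
  have dDF : differentiable (fun y => 'D_w (Fhat c) y) (coord c p.2).
    have [_ C2] := @Fhat_smooth _ _ _ _ F_smooth c 2; have [dD _] := C2 w.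
    by apply: dD; exists p.2.
  have e1 : mxform (DG T) (xi p c) (hcons w0 w) =
      - (2 * (r' / r) * kappa * a * u * w0) - kappa * a * mxform (Dg f) f w.
    rewrite E TE' DGE derive_gram_warped// DgE DgZ innerZl fw.
    rewrite mxformZm mxformZl -/r -/r'; move: (mxform (Dg f) f w) => m1.
    field. exact: r0.
  have e2 : mxform (DG (xi p c)) T (hcons w0 w) =
      2 * r * r' * a * kappa * w0 - a * kappa * mxform (Dg f) f w.
    rewrite E TE' DGE derive_gram_warped// DgE DgZ innerZl fw.
    rewrite mxformZm mxformZl -/r -/r'; move: (mxform (Dg f) f w) => m1.
    field. exact: r0.
  have e3 : mxform (DG (hcons w0 w)) T (xi p c) =
      - (2 * (r' / r) * w0 * kappa * a * u) - kappa * a * mxform (Dg w) f f.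
    rewrite E TE' DGE derive_gram_warped// DgE innerZl innerZr ff.
    rewrite mxformZl mxformZr -/r -/r'; move: (mxform (Dg w) f f) => m1.
    field. exact: r0.
  have TY : innerW c p T (hcons w0 w) = w0.
    by rewrite TE' inner_warped innerZl fw -/r /kappa; field.
  have s2 := derive_sqr_gradient hN F_smooth B_F w cp.
  rewrite /= (derive_B_F hN F_smooth B_F gradF_neq0 w cp) -/w0 -/mu -/f in s2.
  rewrite DgE in s2.
  have s1 := deriveZv kappa f dDF.
  rewrite /h innerB TY covE LY e1 e2 e3 s1.
  have -> : kappa *: 'D_f (fun y => 'D_w (Fhat c) y) (coord c p.2) =
      kappa * ((mu * w0 + mxform (Dg w) f f) / 2).
    by rewrite s2 subrK mulrAC mulfV ?mul1r// pnatr_eq0.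
  move: (mxform (Dg f) f w) (mxform (Dg w) f f) => m1 m2.
  by field.
have hE : h = hcons ('D_(rsubmx h) (Fhat c) (coord c p.2)) (rsubmx h).
  rewrite -[LHS]hconsK; congr hcons.
  move: hxi; rewrite E -{1}(hconsK h) inner_warped innerZr -/f -/r.
  rewrite (innerC hN _ _ cp) inner_gradient// => hxi.
  apply: (mulIf a0); move/eqP: hxi; rewrite addr_eq0 => /eqP ->.
  by field.
by apply/eqP/negP => /negP/gp; rewrite {2}hE hT ltxx.
Qed.

End Normal.

(** The gradient of [t - F x] has squared norm [1 + u / rho^2]; normalizing it
    gives a unit normal.  The formula makes sense on the whole product, and this
    global field serves as its own local extension. *)
Definition normal_scale (p : W) : R := (Num.sqrt (rho p.1 ^+ 2 + B (F p.2)))^-1.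

Definition graph_normal : vector_field W := fun p c =>
  hcons (rho p.1 * normal_scale p)
    (- (normal_scale p / rho p.1) *: gradient F p.2 c).

Lemma normal_scale_sqr p : normal_scale p ^+ 2 * (rho p.1 ^+ 2 + B (F p.2)) = 1.
Proof.
have D0 : 0 < rho p.1 ^+ 2 + B (F p.2).
  by rewrite addr_gt0 ?exprn_gt0//; exact: B_gt0.
by rewrite /normal_scale exprVn sqr_sqrtr ?ltW// mulVf// gt_eqF.
Qed.

Lemma Ck_graph_normal c k : Ck k (@rsubmx R 1 1 n @^-1` hat c)
  (fun y => graph_normal (paramW c y) c).
Proof.
set D := @rsubmx R 1 1 n @^-1` _.
have Do : open D by exact: open_warped_hat.
have Crho : Ck k D (fun y : 'rV[R]_(1 + n) => rho (y 0 0)).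
  have C := @Ck_comp_affine R 'rV[R]_(1 + n) R R k setT (fun z => z 0 0)
    (fun h => h 0 0) rho openT (fun y => differentiable_coord y 0 0)
    (fun h y => derive_coord h y 0 0) (rho_smooth k).
  exact: Ck_sub C.
have Co := @open_hat _ _ _ hN c.
have CB := Ck_comp_rsubmx Co (Ck_sqr_gradient hN F_smooth B_F c k).
have CG := Ck_comp_rsubmx Co (Ck_gradient hN F_smooth c k).
have Cs : Ck k D (fun y : 'rV[R]_(1 + n) =>
    (Num.sqrt (rho (y 0 0) ^+ 2 + B (F (param c (rsubmx y)))))^-1).
  have D0 (y : 'rV[R]_(1 + n)) :
      0 < rho (y 0 0) ^+ 2 + B (F (param c (rsubmx y))).
    by rewrite addr_gt0 ?exprn_gt0//; exact: B_gt0.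
  apply: CkV => // [y _|]; first by rewrite gt_eqF// sqrtr_gt0.
  apply: Ck_sqrt => //.
  by apply: (Ck_eq Do _ (CkD Do (CkM Do Crho Crho) CB)) => y _; rewrite expr2.
have CVrho : Ck k D (fun y : 'rV[R]_(1 + n) => (rho (y 0 0))^-1).
  by apply: CkV => // y _; rewrite gt_eqF.
have Cc : Ck k D (fun y : 'rV[R]_(1 + n) =>
    - ((Num.sqrt (rho (y 0 0) ^+ 2 + B (F (param c (rsubmx y)))))^-1
       / rho (y 0 0))).
  have CN1 := @Ck_cst _ _ R k D (-1).
  apply: (Ck_eq Do _ (CkM Do CN1 (CkM Do Cs CVrho))) => y _.
  by rewrite !fctE mulN1r.
exact: (Ck_hcons Do (CkM Do Crho Cs) (Ck_scale Do Cc CG)).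
Qed.

Lemma graph_normal_smooth : smooth_vector_field [set: W] graph_normal.
Proof.
split=> [p c d _ cp dp|c k].
  rewrite /graph_normal (transport_warped hN)//; congr hcons.
  have G := transport_gradient hN cp dp
    (Fhat_differentiable F_smooth cp) (Fhat_differentiable F_smooth dp).
  by rewrite -G [RHS]linearZ.
by rewrite coord_warped_image; exact: Ck_graph_normal.
Qed.

Lemma graph_normalP : unit_normal S graph_normal.
Proof.
split=> [p Sp|p c Sp cp].
  exists setT, graph_normal; split=> //; first exact: openT.
  exact: graph_normal_smooth.
have r0 : rho p.1 != 0 by rewrite gt_eqF.
split=> [|h /(tangent_graphE hN F_smooth Sp cp) ->].
  rewrite /gnorm /graph_normal inner_warped innerZl innerZr (B_F cp).
  rewrite -[RHS]sqrtr1 -(normal_scale_sqr p); congr Num.sqrt.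
  by field.
rewrite /graph_normal inner_warped innerZr (innerC hN _ _ cp).
rewrite inner_gradient//; last exact: Fhat_differentiable.
by field.
Qed.

Lemma normal_height_chart xi c d p : unit_normal S xi -> S p ->
  dom c p.2 -> dom d p.2 -> xi p d 0 0 = xi p c 0 0.
Proof.
move=> [+ _] Sp cp dp => /(_ p Sp)[U [Xi [_ Up [XiT _] XiE]]].
rewrite -(XiE p d)// -(XiE p c)// (XiT p c d)// -[Xi p c in LHS]hconsK.
by rewrite (transport_warped hN)// hcons0E.
Qed.

Lemma graph_canonical_principal_direction :
  canonical_principal_direction S (partial_t rho N).
Proof.
split; first exact: hypersurface_graph.
  by exists graph_normal; exact: graph_normalP.
move=> xi xiN p Sp; split=> [c cp|].
  rewrite (tangential_partE xiN)//.
  rewrite hconsZ.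
  apply: contraTneq (gradF_neq0 cp) => /(congr1 (@rsubmx R 1 1 n)).
  rewrite rsubmx_hcons raddf0 => /eqP; rewrite scaler_eq0 invr_eq0.
  rewrite gt_eqF ?addr_gt0 ?exprn_gt0//; last exact: B_gt0.
  by move=> /= ->.
(* The factor is expressed in an arbitrary chart [c0]; only the first component
   of [xi] depends on it a priori. *)
have [c0 c0p] := rm_cover hN p.2.
exists (principal_curvature p (xi p c0 0 0)) => c cp U Xi ext.
rewrite (covariant_derivative_tangential xiN Sp cp ext).
by rewrite (normal_height_chart xiN Sp c0p cp).
Qed.

End Curvature.

Unset Implicit Arguments.
Set Strict Implicit.
Set Printing Implicit Defensive.

Theorem proposition7 (R : realType) (n : nat) (N : riemannian_data R n)
    (rho : R -> R) (F : N -> R)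
    (hN : is_riemannian_manifold N)
    (rho_smooth : smooth_on [set: R] rho)
    (rho_pos : forall t : R, 0 < rho t)
    (F_smooth : smooth_fun [set: N] F)
    (F_transnormal : transnormal F)
    (gradF_neq0 : forall (x : N) (c : chart N), dom c x -> gradient F x c != 0) :
  canonical_principal_direction (graph_of rho F) (partial_t rho N).
Proof.
have [b [_ bF]] := F_transnormal.
apply: (@graph_canonical_principal_direction _ _ _ _ _ hN rho_smooth rho_pos
  F_smooth (fun s => b s ^+ 2)) => //.
move=> x c cx; rewrite -(bF x c cx) sqr_sqrtr//.
by rewrite ltW// (rm_gram_pos hN)// gradF_neq0.
Qed.
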